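(* Consider the one-queue wireless link described in the context, with $\mu_{b+1}<\lambda<\mu_b$ for some $b\in\{1,\dots,M\}$. There exist constants $C>0$ and $\epsilon_0\in(0,1)$, depending only on the system (the joint distribution of $(a(t),\omega(t))$ and the bound $a_{\max}$), such that the following holds for every $\epsilon\in(0,\epsilon_0]$. Set $$V=\max\left[\tfrac{1}{\gamma}\log(1/\epsilon),\ \omega_M^2\right],\qquad T_\epsilon=\frac{\log(1/\epsilon)}{\epsilon},$$ and run the drift-plus-penalty algorithm with parameter $V$ from an initial condition $Q(0)=q_0$, where $q_0$ is a constant with $0\le q_0\le V/\omega_b$ (for example $q_0=0$). Then: 1. $\overline{Q}(t)\le C\log(1/\epsilon)$ for all slots $t>0$; 2. for all slots $t>T_\epsilon$, $$\overline{\mu}(t)\ge\lambda-C\epsilon\qquad\text{and}\qquad \overline{p}(t)\le p^*+C\epsilon .$$ That is, the algorithm gives an $O(\epsilon)$-approximation with convergence time $O(\log(1/\epsilon)/\epsilon)$ and average queue size $O(\log(1/\epsilon))$.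
   Context: Time is slotted, $t\in\{0,1,2,\dots\}$. The arrivals $a(t)$ satisfy $0\le a(t)\le a_{\max}$ and $\mathbb{E}[a(t)]=\lambda$; the channel state $\omega(t)$ takes values in the finite set $\Omega=\{\omega_0,\omega_1,\dots,\omega_M\}$ with $M\ge 1$ and $0=\omega_0<\omega_1<\cdots<\omega_M$. The pairs $(a(t),\omega(t))$ are i.i.d. over slots. Write $\pi(\omega_k)=\Pr[\omega(t)=\omega_k]$ and assume $\pi(\omega_k)>0$ for $k\in\{1,\dots,M\}$ ($\pi(\omega_0)$ may be zero). Each slot the controller observes $\omega(t)$ and chooses the power $p(t)\in\{0,1\}$; the offered service is $\mu(t)=p(t)\omega(t)$ and the queue evolves as $Q(t+1)=\max[Q(t)+a(t)-\mu(t),0]$, with constant initial condition $Q(0)=q_0\ge 0$. For a process $b(\tau)$ and $t>0$, $\overline{b}(t)=\frac1t\sum_{\tau=0}^{t-1}\mathbb{E}[b(\tau)]$; this defines $\overline{Q}(t),\overline{\mu}(t),\overline{p}(t)$. $p^*$ is the infimum of $\limsup_{t\to\infty}\overline{p}(t)$ over all (causal, possibly randomized) control algorithms with $p(t)\in\{0,1\}$ and $\liminf_{t\to\infty}\overline{\mu}(t)\ge\lambda$. Put $\omega_{M+1}=\infty$, $\mu_{M+1}=0$, and for $k\in\{1,\dots,M\}$, $\mu_k=\sum_{i=k}^M\omega_i\pi(\omega_i)$, so $0=\mu_{M+1}<\mu_M<\cdots<\mu_1=\mathbb{E}[\omega(t)]$. Let $h(\mu)$, $\mu\in[0,\mathbb{E}[\omega(t)]]$,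 be the minimum average power needed for average transmission rate $\mu$; it is the convex piecewise linear function with vertices $(\mu_k,h(\mu_k))$, $h(\mu_k)=\sum_{i=k}^M\pi(\omega_i)$ for $1\le k\le M$, and $h(\mu_{M+1})=h(0)=0$. It is known that $p^*=h(\lambda)$, i.e. $p^*=\theta h(\mu_{b+1})+(1-\theta)h(\mu_b)$ with $\theta=(\mu_b-\lambda)/(\mu_b-\mu_{b+1})$. Drift-plus-penalty algorithm with parameter $V\ge0$: each slot, $p(t)=1$ if $Q(t)\omega(t)\ge V$, and $p(t)=0$ otherwise. Constants: $\delta_{\max}=\max[\omega_M,a_{\max}]$, $\beta_L=\lambda-\mu_{b+1}$, $\beta_R=\mu_b-\lambda$, $$r_R=\frac{\beta_R}{\delta_{\max}^2+\delta_{\max}\beta_R/3},\qquad r_L=\frac{\beta_L}{\delta_{\max}^2+\delta_{\max}\beta_L/3},$$ $$\gamma=\min\left[r_R\left(\frac1{\omega_{b-1}}-\frac1{\omega_b}\right),\ r_L\left(\frac1{\omega_b}-\frac1{\omega_{b+1}}\right)\right],$$ with conventions $1/\omega_0=\infty$ and $1/\omega_{M+1}=0$. $\log$ is the natural logarithm. *)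

(* Defs.v *)
From HB Require Import structures.
From mathcomp Require Import all_boot all_order all_algebra finmap.
From mathcomp Require Import all_classical all_reals all_analysis.
Set Implicit Arguments.
Unset Strict Implicit.
Unset Printing Implicit Defensive.
Import Order.TTheory GRing.Theory Num.Theory.
Import numFieldNormedType.Exports.
Local Open Scope classical_set_scope.
Local Open Scope ring_scope.

(* The law of one slot (a(t), omega(t)) is a probability on the Borel plane;
   a(t) and omega(t) of the same slot may be dependent. *)
Definition slot_law (R : realType) : Type :=
  probability (measurableTypeR R * measurableTypeR R)%type R.

Definition mutually_independent d d' (T : measurableType d)
    (T' : measurableType d') (R : realType) (P : probability T R)
    (X : nat -> T -> T') : Prop :=
  forall (J : {fset nat}) (A : nat -> set T'),
    (forall i, measurable (A i)) ->
    P (\bigcap_(i in [set` J]) (X i @^-1` A i)) =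
    (\prod_(i <- J) P (X i @^-1` A i))%E.

Definition slot_pair d (T : measurableType d) (R : realType)
    (P : probability T R) (a w : {RV P >-> R}^nat) (t : nat) (z : T) :
    (measurableTypeR R * measurableTypeR R)%type :=
  (a t z, w t z).

Definition iid_slots (R : realType) (nu : slot_law R) d
    (T : measurableType d) (P : probability T R) (a w : {RV P >-> R}^nat) :
    Prop :=
  (forall t (A : set (measurableTypeR R * measurableTypeR R)%type),
      measurable A -> P (slot_pair a w t @^-1` A) = nu A) /\
  mutually_independent P (slot_pair a w).

Definition time_avg d (T : measurableType d) (R : realType)
    (P : probability T R) (f : nat -> T -> R) (t : nat) : \bar R :=
  ((t%:R^-1)%:E * \sum_(0 <= s < t) 'E_P[f s])%E.

(* Powers p(t) in {0,1} are encoded as booleans. *)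
Definition power d (T : measurableType d) (R : realType)
    (p : nat -> T -> bool) (t : nat) (z : T) : R := (p t z)%:R.

Definition service d (T : measurableType d) (R : realType)
    (p : nat -> T -> bool) (w : nat -> T -> R) (t : nat) (z : T) : R :=
  (p t z)%:R * w t z.

(* Information available when p(t) is chosen: the randomization seed, the
   arrivals of the slots before t, and the channel states up to t included.
   Queue lengths up to slot t are functions of this information. *)
Definition information d d' (T : measurableType d) (S : measurableType d')
    (R : realType) (seed : T -> S) (a w : nat -> T -> R) (t : nat) :
    set (set T) :=
  <<s preimage_set_system setT seed measurable
      `|` \bigcup_(s in [set s | (s < t)%N])
            preimage_set_system setT (a s) measurable
      `|` \bigcup_(s in [set s | (s <= t)%N])
            preimage_set_system setT (w s) measurable >>.

Definition independent_seed d d' (T : measurableType d)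
    (S : measurableType d') (R : realType) (P : probability T R)
    (seed : T -> S) (a w : {RV P >-> R}^nat) : Prop :=
  forall (B : set S) (J : {fset nat})
         (A : nat -> set (measurableTypeR R * measurableTypeR R)%type),
    measurable B -> (forall i, measurable (A i)) ->
    P (seed @^-1` B `&` \bigcap_(i in [set` J]) (slot_pair a w i @^-1` A i)) =
    (P (seed @^-1` B) *
     P (\bigcap_(i in [set` J]) (slot_pair a w i @^-1` A i)))%E.

(* A causal, possibly randomized control algorithm p for the slot process
   (a, w). The seed may take values in any measurable space, so it can carry
   fresh randomness for every slot; deterministic algorithms ignore it. *)
Definition control_algorithm d (T : measurableType d) (R : realType)
    (P : probability T R) (a w : {RV P >-> R}^nat) (p : nat -> T -> bool) :
    Prop :=
  exists d' (S : measurableType d') (seed : {mfun T >-> S}),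
    independent_seed seed a w /\
    forall t, information seed a w t [set z | p t z].

(* The infimum ranges over all probability spaces carrying i.i.d. slots of
   law nu, so that p* depends only on nu and lambda. *)
Definition pstar (R : realType) (nu : slot_law R) (lambda : R) : \bar R :=
  ereal_inf [set x : \bar R |
    exists d (T : measurableType d) (P : probability T R)
           (a w : {RV P >-> R}^nat) (p : nat -> T -> bool),
      [/\ iid_slots nu a w, control_algorithm a w p,
          (lambda%:E <= limn_einf (time_avg P (service p w)))%E &
          x = limn_esup (time_avg P (power R p))]].

Definition dpp_decision (R : realType) (V q w : R) : bool := V <= q * w.

Fixpoint dpp_queue (T : Type) (R : realType) (V q0 : R) (a w : nat -> T -> R)
    (t : nat) (z : T) : R :=
  if t is s.+1 then
    let q := dpp_queue V q0 a w s z in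
    Num.max (q + a s z - (dpp_decision V q (w s z))%:R * w s z) 0
  else q0.

Definition dpp_power (T : Type) (R : realType) (V q0 : R) (a w : nat -> T -> R)
    (t : nat) (z : T) : bool :=
  dpp_decision V (dpp_queue V q0 a w t z) (w t z).

Section Constants.
(* Channel states are st 0 < ... < st M; values of st beyond M are unused. *)
Context (R : realType) (nu : slot_law R) (M : nat) (st : nat -> R)
        (amax lambda : R) (b : nat).

Definition state_prob (k : nat) : R := fine (nu [set z | z.2 = st k]).

(* For k = M+1 the sum is empty, so mu_{M+1} = 0. *)
Definition rate (k : nat) : R := \sum_(k <= i < M.+1) st i * state_prob i.

Definition delta_max : R := Num.max (st M) amax.
Definition beta_L : R := lambda - rate b.+1.
Definition beta_R : R := rate b - lambda.
Definition r_R : R := beta_R / (delta_max ^+ 2 + delta_max * beta_R / 3).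
Definition r_L : R := beta_L / (delta_max ^+ 2 + delta_max * beta_L / 3).

(* Reciprocal of omega_k for 1 <= k <= M+1, with omega_{M+1} infinite. *)
Definition inv_state (k : nat) : R := if (k <= M)%N then (st k)^-1 else 0.

(* When b = 1, 1/omega_0 is infinite and the first term of the minimum drops
   out (r_R > 0 under the standing assumptions). *)
Definition gamma : R :=
  let left_term := r_L * (inv_state b - inv_state b.+1) in
  if b == 1%N then left_term
  else Num.min (r_R * (inv_state b.-1 - inv_state b)) left_term.

Definition V_param (eps : R) : R :=
  Num.max (gamma^-1 * ln (eps^-1)) (st M ^+ 2).

End Constants.

Definition T_conv (R : realType) (eps : R) : R := ln (eps^-1) / eps.

(* Main.v *)
Require Import Defs.
From mathcomp Require Import all_boot all_order all_algebra.
From mathcomp Require Import all_classical all_reals all_analysis.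
From mathcomp Require Import measurable_realfun finmap ring lra.
Set Implicit Arguments.
Unset Strict Implicit.
Unset Printing Implicit Defensive.
Import Order.TTheory GRing.Theory Num.Theory.
Import numFieldNormedType.Exports.
Local Open Scope classical_set_scope.
Local Open Scope ring_scope.

(* Neely's drift argument. Since [V >= omega_M ^ 2], a slot is served only when the
   queue can afford it, so the queue never truncates and the average service is
   [lambda - (E Q(t) - q0) / t]. Above [V / omega_b] the queue has drift at most
   [- beta_R], below it drift at least [beta_L]; a Bernstein estimate makes
   [expR (r_R (Q - V / omega_b))] and [expR (r_L (V / omega_b - Q))] contract up
   to an additive constant. The first moment bounds [E Q(t)] and, through Markov,
   the time spent above [V / omega_(b-1)]; the second one bounds the time spent
   below [V / omega_(b+1)], apart from a transient of order [V]. By the choice of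
   gamma both fractions of time are O(eps).

   For power, compare with the affine function through the two vertices of [h]
   around [lambda]: any decision satisfies
   [p >= min(0, 1 - omega / omega_b) + p omega / omega_b], with equality for the
   algorithm as long as [V / omega_(b+1) <= Q < V / omega_(b-1)]. Averaging the
   inequality over an arbitrary policy bounds [pstar] from below; averaging the
   equality bounds the algorithm. *)

(** * Real inequalities *)

(** The difference [f] of the two sides vanishes at 0 together with its derivative [df], and it is
    convex: three times its second derivative is [1 - expR x * (1 - x)], nonnegative because
    [1 - x <= expR (- x)]. *)
Lemma expR_le_bernstein (R : realType) (y : R) :
  (1 - y / 3) * (expR y - 1 - y) <= y ^+ 2 / 2.
Proof.
pose df (x : R) : R := expR x * (x / 3 - 2 / 3) + x / 3 + 2 / 3.
pose f (x : R) : R := x ^+ 2 / 2 - (1 - x / 3) * (expR x - 1 - x).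
have ddf (x : R) : is_derive x 1 df (expR x * (x / 3 - 3^-1) + 3^-1).
  by apply: is_derive_eq; rewrite /GRing.scale /=; field.
have dfE (x : R) : is_derive x 1 f (df x).
  by apply: is_derive_eq; rewrite /GRing.scale /= /df; field.
have ddf0 (x : R) : 0 <= expR x * (x / 3 - 3^-1) + 3^-1.
  have h := expR_ge1Dx (- x); rewrite expRN in h.
  have h2 : 0 < expR x := expR_gt0 x.
  by move: h; rewrite -(ler_pM2l h2) mulfV ?gt_eqF// => h; lra.
have cdf u v : {within `[u, v], continuous df}.
  apply: derivable_within_continuous => c _; exact: ex_derive.
have df_mono : {homo df : x z / x <= z}.
  move=> x z; rewrite le_eqVlt => /orP[/eqP->//|xz].
  have [c _ h] := MVT xz (fun c _ => ddf c) (cdf _ _).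
  by rewrite -subr_ge0 h mulr_ge0 ?ddf0// subr_ge0 ltW.
have df0 : df 0 = 0 by rewrite /df expR0; field.
have f0 : f 0 = 0 by rewrite /f expR0; field.
have cf u v : {within `[u, v], continuous f}.
  apply: derivable_within_continuous => c _; exact: ex_derive.
rewrite -subr_ge0 -/(f y); have [y0|y0|->] := ltgtP y 0; last by rewrite f0.
- have [c] := MVT y0 (fun c _ => dfE c) (cf _ _).
  rewrite in_itv/= f0 => /andP[_ c0] h.
  have := df_mono _ _ (ltW c0); rewrite df0 => ?; nra.
- have [c] := MVT y0 (fun c _ => dfE c) (cf _ _).
  rewrite in_itv/= f0 => /andP[c0 _] h.
  have := df_mono _ _ (ltW c0); rewrite df0 => ?; nra.
Qed.

(** Since [expR y - 1 - y] is nonnegative, the factor [1 - y / 3] of the previous lemma may be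
    lowered to its worst value [1 - c / 3], and then divided out. *)
Lemma expR_le_quadratic (R : realType) (c y : R) : y <= c -> c < 3 ->
  expR y <= 1 + y + y ^+ 2 / 2 / (1 - c / 3).
Proof.
move=> yc c3; have c0 : 0 < 1 - c / 3 by lra.
have e0 : 0 <= expR y - 1 - y by have := expR_ge1Dx y; lra.
suff : expR y - 1 - y <= y ^+ 2 / 2 / (1 - c / 3) by lra.
rewrite ler_pdivlMr// (le_trans _ (expR_le_bernstein y))// mulrC ler_wpM2r//.
lra.
Qed.

(* [2 * ln (1 + G) / (1 - rho)] is a potential: replacing [G] by [rho * G] lowers
   it by at least [min 1 G]. *)
Lemma sum_min1_geometric_le (R : realType) (rho G : R) (t : nat) :
  0 <= rho < 1 -> 0 <= G ->
  \sum_(0 <= s < t) Num.min 1 (rho ^+ s * G) <= 2 * ln (1 + G) / (1 - rho).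
Proof.
move=> /andP[rho0 rho1]; have r1 : 0 < 1 - rho by lra.
elim: t G => [|t IH] G G0.
  by rewrite big_geq// divr_ge0 ?(ltW r1)// mulr_ge0// ln_ge0; lra.
rewrite big_nat_recl// expr0 mul1r.
under eq_bigr do rewrite exprSr -mulrA.
have rG0 : 0 <= rho * G by rewrite mulr_ge0.
apply: (le_trans (lerD (lexx _) (IH _ rG0))).
rewrite ler_pdivlMr// mulrDl divfK ?gt_eqF//.
(* [x] is the relative loss of [1 + G] when [G] becomes [rho * G]; as [ln (1 - x) <= - x], the
   potential drops by at least [2 * x / (1 - rho)]. *)
pose x := (1 - rho) * G / (1 + G).
have G1 : 0 < 1 + G by lra.
have xE : 1 + rho * G = (1 - x) * (1 + G) by rewrite /x; field; rewrite gt_eqF.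
have x1 : 0 < 1 - x by rewrite -(pmulr_lgt0 _ G1) -xE; lra.
have lnx : ln (1 - x) <= - x by by apply: le_ln1Dx; lra.
have minx : Num.min 1 G * (1 - rho) <= 2 * x.
  rewrite /x mulrA ler_pdivlMr//.
  have : Num.min 1 G * (1 + G) <= 2 * G by case: (leP 1 G) => ?; nra.
  by move=> ?; nra.
rewrite xE lnM ?posrE//; lra.
Qed.

(** This [r] makes the second-order term of [expR_le_quadratic], with [c = r * delta], cancel
    exactly half of the first-order gain [r * beta]. *)
Lemma exp_moment_rate (R : realType) (delta beta : R) : 0 < delta -> 0 < beta ->
  let r := beta / (delta ^+ 2 + delta * beta / 3) in
  [/\ 0 < r, r * delta < 3 &
      (r * delta) ^+ 2 / 2 / (1 - r * delta / 3) = r * beta / 2].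
Proof.
move=> d0 b0 r; have db : 0 < delta * beta by rewrite mulr_gt0.
have d2 : 0 < delta ^+ 2 by rewrite exprn_gt0.
have den0 : 0 < delta ^+ 2 + delta * beta / 3 by lra.
split; first by rewrite divr_gt0.
  rewrite /r mulrAC ltr_pdivrMr//; lra.
have -> : 1 - r * delta / 3 = r * delta ^+ 2 / beta.
  by rewrite /r; field; rewrite !gt_eqF//; nra.
have r0 : 0 < r by rewrite divr_gt0.
by field; rewrite !gt_eqF.
Qed.

(** * Integrals and independence *)

Section probability_integrals.
Context d (T : measurableType d) (R : realType) (P : probability T R).
Implicit Types f g : T -> R.

Lemma ae_bounded_integrable f (K : R) : measurable_fun setT f ->
  {ae P, forall x, `|f x| <= K} -> P.-integrable setT (EFin \o f).
Proof.
move=> mf fK; apply/integrableP; split; first exact/measurable_EFinP.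
apply: (@le_lt_trans _ _ (\int[P]_x (Num.max K 0)%:E)%E); last first.
  by rewrite integral_cst//= probability_setT mule1 ltry.
apply: ae_ge0_le_integral => //.
- apply/measurableT_comp => //; exact/measurable_EFinP.
- by move=> x _; rewrite lee_fin le_max lexx orbT.
- by apply: filterS fK => x fxK _; rewrite /= lee_fin le_max fxK.
Qed.

Lemma expectation_Rintegral f : P.-integrable setT (EFin \o f) ->
  'E_P[f]%E = (\int[P]_x f x)%:E.
Proof.
by move=> intf; rewrite unlock /Rintegral fineK// integrable_fin_num.
Qed.

Lemma ae_le_Rintegral f g :
  P.-integrable setT (EFin \o f) -> P.-integrable setT (EFin \o g) ->
  {ae P, forall x, f x <= g x} -> \int[P]_x f x <= \int[P]_x g x.
Proof.
move=> intf intg fg; rewrite -subr_ge0 -RintegralB// /Rintegral.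
have [mf mg] := (measurable_int _ intf, measurable_int _ intg).
have mfR : measurable_fun setT f by exact/measurable_EFinP.
have mgR : measurable_fun setT g by exact/measurable_EFinP.
(* The absolute value changes [g - f] only on a null set and is nonnegative everywhere. *)
rewrite (@ae_eq_integral _ _ _ _ _ (fun x => `|g x - f x|%:E)) //.
- by apply/fine_ge0/integral_ge0 => x _; rewrite lee_fin.
- apply/measurable_EFinP; exact: measurable_funB.
- apply/measurable_EFinP/measurableT_comp => //; exact: measurable_funB.
- by apply: filterS fg => x fgx _; rewrite /= ger0_norm// subr_ge0.
Qed.

Lemma ae_eq_Rintegral f g :
  P.-integrable setT (EFin \o f) -> P.-integrable setT (EFin \o g) ->
  {ae P, forall x, f x = g x} -> \int[P]_x f x = \int[P]_x g x.
Proof.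
move=> intf intg fg; apply/eqP; rewrite eq_le !ae_le_Rintegral//.
- by apply: filterS fg => x ->.
- by apply: filterS fg => x ->.
Qed.

End probability_integrals.

Lemma Rintegral_law d d' (T : measurableType d) (U : measurableType d')
    (R : realType) (P : probability T R) (nu : probability U R) (X : T -> U)
    (g : U -> R) : measurable_fun setT X -> measurable_fun setT g ->
  (forall A, measurable A -> P (X @^-1` A) = nu A) ->
  P.-integrable setT (EFin \o (g \o X)) ->
  \int[P]_x g (X x) = \int[nu]_y g y.
Proof.
move=> mX mg PX intg; rewrite /Rintegral; congr fine.
have mgE : measurable_fun setT (EFin \o g) by exact/measurable_EFinP.
transitivity (\int[pushforward P X]_y (g y)%:E)%E.
  by rewrite (integral_pushforward mX mgE).
by apply: eq_measure_integral => A mA _; exact: PX.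
Qed.

Lemma ae_law d d' (T : measurableType d) (U : measurableType d')
    (R : realType) (P : probability T R) (nu : probability U R) (X : T -> U)
    (Q : U -> Prop) : measurable_fun setT X ->
  (forall A, measurable A -> P (X @^-1` A) = nu A) ->
  {ae nu, forall y, Q y} -> {ae P, forall x, Q (X x)}.
Proof.
move=> mX PX [N [mN nuN QN]]; exists (X @^-1` N); split => //.
- by rewrite -[X in measurable X]setTI; exact: mX.
- by rewrite PX.
- by move=> x /= nQ; exact: QN.
Qed.

Section independence.
Context d d1 d2 (T : measurableType d) (S : measurableType d1)
  (U : measurableType d2) (R : realType) (P : probability T R).

(** The joint law agrees with the product of the marginals on rectangles, hence everywhere;
    nonnegativity of [f] and [g] then allows Tonelli. *)
Lemma Rintegral_indepM (Y : T -> S) (X : T -> U) (f : S -> R) (g : U -> R) :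
  measurable_fun setT Y -> measurable_fun setT X ->
  measurable_fun setT f -> measurable_fun setT g ->
  (forall y, 0 <= f y) -> (forall x, 0 <= g x) ->
  P.-integrable setT (EFin \o (f \o Y)) ->
  P.-integrable setT (EFin \o (g \o X)) ->
  (forall A B, measurable A -> measurable B ->
    P (Y @^-1` A `&` X @^-1` B) = (P (Y @^-1` A) * P (X @^-1` B))%E) ->
  \int[P]_z (f (Y z) * g (X z)) = \int[P]_z f (Y z) * \int[P]_z g (X z).
Proof.
move=> mY mX mf mg f0 g0 intf intg indYX.
pose Y' : {mfun T >-> S} := mfun_Sub (mem_set mY).
pose X' : {mfun T >-> U} := mfun_Sub (mem_set mX).
have mYX : measurable_fun setT (fun z => (Y z, X z)).
  exact: measurable_fun_pair.
pose YX : {mfun T >-> (S * U)%type} := mfun_Sub (mem_set mYX).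
have mfE : measurable_fun setT (fun y => (f y)%:E) by exact/measurable_EFinP.
have mgE : measurable_fun setT (fun y => (g y)%:E) by exact/measurable_EFinP.
have mh : measurable_fun setT (fun yx : S * U => (f yx.1 * g yx.2)%:E).
  apply/measurable_EFinP/measurable_funM.
  - exact: measurableT_comp.
  - exact: measurableT_comp.
have intYf := integrable_fin_num measurableT intf.
have intXg := integrable_fin_num measurableT intg.
rewrite /Rintegral -fineM//; congr fine.
pose PY := distribution P Y'; pose PX := distribution P X'.
transitivity (\int[distribution P YX]_yx (f yx.1 * g yx.2)%:E)%E.
  rewrite ge0_integral_distribution// => y; rewrite lee_fin mulr_ge0//.
transitivity (\int[(PY \x PX)%E]_yx (f yx.1 * g yx.2)%:E)%E.
  apply: eq_measure_integral => A mA _.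
  exact/esym/product_measure_unique.
rewrite fubini_tonelli1//; last by move=> yx; rewrite lee_fin mulr_ge0.
rewrite /fubini_F /=.
have inner y : (\int[PX]_x (f y * g x)%:E = (f y)%:E * \int[PX]_x (g x)%:E)%E.
  under eq_integral do rewrite EFinM.
  by rewrite ge0_integralZl// ?lee_fin// => x _; rewrite lee_fin.
under eq_integral do rewrite inner.
rewrite ge0_integralZr//.
- by rewrite !ge0_integral_distribution// => y; rewrite lee_fin.
- by move=> y _; rewrite lee_fin.
- by apply: integral_ge0 => x _; rewrite lee_fin.
Qed.

(** [Y t] is determined by the slots before [t], so it is independent of the later ones. The
    induction carries all finite families [J] of slots from [t] on, because its step moves slot [t]
    into [J]. *)
Lemma recursion_indep (Y : nat -> T -> S) (X : nat -> T -> U)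
    (F : S * U -> S) (y0 : S) :
  measurable_fun setT F -> (forall t, measurable_fun setT (X t)) ->
  Y 0%N = cst y0 -> (forall t z, Y t.+1 z = F (Y t z, X t z)) ->
  mutually_independent P X ->
  forall t (J : {fset nat}) (A : nat -> set U) (B : set S),
  (forall i, i \in J -> (t <= i)%N) -> (forall i, measurable (A i)) ->
  measurable B ->
  P (Y t @^-1` B `&` \bigcap_(i in [set` J]) X i @^-1` A i) =
  (P (Y t @^-1` B) * P (\bigcap_(i in [set` J]) X i @^-1` A i))%E.
Proof.
move=> mF mX Y0 YS indX.
have mY t : measurable_fun setT (Y t).
  elim: t => [|t IH]; first by rewrite Y0; exact: measurable_cst.
  rewrite (_ : Y t.+1 = F \o (fun z => (Y t z, X t z))).
    by apply: measurableT_comp => //; exact: measurable_fun_pair.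
  by apply/funext => z; rewrite YS.
have mcap (J : {fset nat}) (A : nat -> set U) : (forall i, measurable (A i)) ->
    measurable (\bigcap_(i in [set` J]) X i @^-1` A i).
  move=> mA; apply: bigcap_measurableType => i _.
  by rewrite -[X in measurable X]setTI; exact: mX.
elim=> [|t IH] J A B tJ mA mB.
  rewrite Y0 preimage_cst; case: ifPn => _.
    by rewrite setTI probability_setT mul1e.
  by rewrite set0I measure0 mul0e.
pose E := \bigcap_(i in [set` J]) X i @^-1` A i.
have mE : measurable E by exact: mcap.
have mYX : measurable_fun setT (fun z => (Y t z, X t z)).
  exact: measurable_fun_pair.
(* Slot [t] lies outside [J], so a constraint on [X t] is one more index of the intersection, to
   which the induction hypothesis applies. *)
have cap_add C : measurable C -> X t @^-1` C `&` E =
    \bigcap_(i in [set` (t |` J)%fset]) X i @^-1` (if i == t then C else A i).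
  move=> mC; apply/seteqP; split => z.
    move=> [Cz Ez] i /=; rewrite in_fset1U => /orP[/eqP->|iJ].
      by rewrite eqxx.
    case: eqP => [->//|_]; exact: Ez.
  move=> h; split=> [|i iJ].
    by have := h t; rewrite /= in_fset1U eqxx; exact.
  have := h i; rewrite /= in_fset1U iJ orbT => /(_ isT).
  by case: eqP => // it; have := tJ _ iJ; rewrite it ltnn.
have mif C : measurable C ->
    forall i, measurable (if i == t then C else A i).
  by move=> mC i; case: ifP.
have tJ' i : i \in (t |` J)%fset -> (t <= i)%N.
  by rewrite in_fset1U => /orP[/eqP->//|/tJ /ltnW].
have indXE C : measurable C ->
  P (X t @^-1` C `&` E) = (P (X t @^-1` C) * P E)%E.
  move=> mC; rewrite cap_add// indX//; last exact: mif.
  rewrite big_fsetU1/=; last by apply/negP => /tJ; rewrite ltnn.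
  rewrite eqxx indX//; congr (_ * _)%E.
  rewrite big_seq [RHS]big_seq; apply: eq_bigr => i /tJ ti.
  by rewrite gtn_eqF.
have indYX B' C : measurable B' -> measurable C ->
    P (Y t @^-1` B' `&` X t @^-1` C) = (P (Y t @^-1` B') * P (X t @^-1` C))%E.
  move=> mB' mC; have := IH [fset t]%fset (fun=> C) B'.
  rewrite set_fset1 bigcap_set1; apply => // i.
  by rewrite in_fset1 => /eqP ->.
have PE0 : 0 <= fine (P E) by rewrite fine_ge0.
pose YX : {mfun T >-> (S * U)%type} := mfun_Sub (mem_set mYX).
(* [m1] is the law of [(Y t, X t)] restricted to [E], [m2] the same law scaled by [P E]. They agree
   on rectangles, a pi-system, hence on the preimage of [B] under [F]. *)
pose m1 := pushforward (mrestr P mE) YX.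
pose m2 := mscale (NngNum PE0) (distribution P YX).
have PEfin : (fine (P E))%:E = P E by rewrite fineK// fin_num_measure.
have m12 C : measurable C -> m1 C = m2 C.
  apply: (measure_unique
    [set A `*` B | A in @measurable _ S & B in @measurable _ U]
    (fun=> setT)) => //.
  - exact: measurable_prod_measurableType.
  - move=> _ _ [A1 mA1 [B1 mB1 <-]] [A2 mA2 [B2 mB2 <-]].
    by rewrite -setXI; exists (A1 `&` A2); [exact: measurableI|];
      exists (B1 `&` B2); [exact: measurableI|].
  - by move=> _; exists setT => //; exists setT => //; rewrite setXTT.
  - by rewrite bigcup_const.
  - move=> _ [B1 mB1 [C1 mC1 <-]].
    change (P ((Y t @^-1` B1 `&` X t @^-1` C1) `&` E) =
      ((fine (P E))%:E * P (Y t @^-1` B1 `&` X t @^-1` C1))%E).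
    rewrite PEfin.
    rewrite indYX// -setIA cap_add// IH//; last exact: mif.
    rewrite -cap_add// indXE// muleA muleC //.
  - move=> _; change (P (setT `&` E) < +oo)%E.
    by rewrite (le_lt_trans (probability_le1 _ _)) ?ltry//; exact: measurableI.
have YSE : Y t.+1 @^-1` B = (fun z => (Y t z, X t z)) @^-1` (F @^-1` B).
  by apply/seteqP; split => z /=; rewrite YS.
have mFB : measurable (F @^-1` B).
  by rewrite -[X in measurable X]setTI; exact: mF.
have := m12 _ mFB; rewrite YSE muleC -PEfin; exact.
Qed.


Lemma recursion_indep_current (Y : nat -> T -> S) (X : nat -> T -> U)
    (F : S * U -> S) (y0 : S) :
  measurable_fun setT F -> (forall t, measurable_fun setT (X t)) ->
  Y 0%N = cst y0 -> (forall t z, Y t.+1 z = F (Y t z, X t z)) ->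
  mutually_independent P X ->
  forall t A B, measurable A -> measurable B ->
  P (Y t @^-1` A `&` X t @^-1` B) = (P (Y t @^-1` A) * P (X t @^-1` B))%E.
Proof.
move=> mF mX Y0 YS indX t A B mA mB.
have := recursion_indep mF mX Y0 YS indX (J := [fset t]%fset) (A := fun=> B) _
  _ mA.
rewrite set_fset1 bigcap_set1; apply => // i.
by rewrite in_fset1 => /eqP ->.
Qed.

End independence.

(** * Exponential moments under negative drift *)

Lemma geometric_recursion_le (R : realType) (m : nat -> R) (rho D : R) :
  0 <= rho < 1 -> 0 <= D -> (forall t, m t.+1 <= rho * m t + D) ->
  forall t, m t <= rho ^+ t * m 0%N + D / (1 - rho).
Proof.
move=> /andP[rho0 rho1] D0 mS; have r1 : 0 < 1 - rho by lra.
elim=> [|t IH].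
  by rewrite expr0 mul1r lerDl divr_ge0 // ltW.
apply: le_trans (mS t) _.
(* [D / (1 - rho)] is the fixed point of the recursion. *)
have -> : D / (1 - rho) = rho * (D / (1 - rho)) + D by field; rewrite gt_eqF.
by rewrite exprS -mulrA addrA lerD2r -mulrDr ler_wpM2l.
Qed.

Lemma measurable_natr_bool d (T : measurableType d) (R : realType)
    (b : T -> bool) : measurable_fun setT b ->
  measurable_fun setT (fun z => (b z)%:R : R).
Proof.
move=> mb; rewrite (_ : (fun z => _) = (fun z => if b z then 1 else 0)).
  exact: measurable_fun_ifT.
by apply/funext => z; case: (b z).
Qed.

Lemma exp_integrable d (T : measurableType d) (R : realType)
    (P : probability T R) (f : T -> R) (r K : R) :
  measurable_fun setT f -> {ae P, forall z, f z <= K} -> 0 <= r ->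
  P.-integrable setT (EFin \o (fun z => expR (r * f z))).
Proof.
move=> mf fK r0; apply: (@ae_bounded_integrable _ _ _ _ _ (expR (r * K))).
  by apply: measurableT_comp => //; exact: measurable_funM.
apply: filterS fK => z fzK.
by rewrite ger0_norm ?expR_ge0// ler_expR ler_wpM2l.
Qed.

Section exponential_moments.
Context d d' (T : measurableType d) (U : measurableType d') (R : realType).

(** Integrate [expR_le_quadratic]: the linear term has mean at most [- r * beta], and the quadratic
    one, bounded through [delta], returns only [r * beta / 2]. *)
Lemma bernstein_exp_moment (nu : probability U R) (xi : U -> R)
    (delta beta r : R) : 0 < delta -> 0 < beta ->
  r = beta / (delta ^+ 2 + delta * beta / 3) ->
  measurable_fun setT xi -> {ae nu, forall x, `|xi x| <= delta} ->
  \int[nu]_x xi x <= - beta ->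
  \int[nu]_x expR (r * xi x) <= 1 - r * beta / 2.
Proof.
move=> d0 b0 rE' mxi xid mean.
have [r0 rd3 rE] := exp_moment_rate d0 b0; rewrite -rE' in r0 rd3 rE.
have intxi : nu.-integrable setT (EFin \o xi).
  exact: ae_bounded_integrable mxi xid.
have intrxi : nu.-integrable setT (EFin \o (fun x => r * xi x)).
  by rewrite (_ : EFin \o _ = (fun x => r%:E * (xi x)%:E)%E)//;
    exact: integrableZl.
have intc (c : R) : nu.-integrable setT (EFin \o (fun=> c : R)).
  by apply: (@ae_bounded_integrable _ _ _ _ _ `|c|) => //; exact: nearW.
have intq : nu.-integrable setT (EFin \o (fun x => r * xi x + (1 + r * beta /
  2))).
  by apply: (@integrableD _ _ _ _ _ _ (EFin \o _) (EFin \o _)) => //;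
    exact: intc.
apply: (@le_trans _ _ (\int[nu]_x (r * xi x + (1 + r * beta / 2)))).
  apply: ae_le_Rintegral => //.
    apply: exp_integrable => //; last exact: ltW.
    by apply: filterS xid => x; rewrite ler_norml => /andP[_]; exact.
  apply: filterS xid => x xix.
  have ry : r * xi x <= r * delta.
    by rewrite ler_pM2l// (le_trans (ler_norm _)).
  apply: (le_trans (expR_le_quadratic ry rd3)).
  rewrite -rE addrC addrA [1 + _]addrC -addrA.
  rewrite [X in _ <= X]addrA [X in _ <= X + _]addrC addrC lerD2l.
  rewrite ler_pM2r ?invr_gt0; last by lra.
  rewrite ler_pM2r ?invr_gt0// !exprMn ler_pM2l ?exprn_gt0//.
  by rewrite -real_normK ?num_real// ler_sqr ?nnegrE// ltW.
rewrite RintegralD// RintegralZl// Rintegral_cst//= probability_setT mulr1.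
have : r * \int[nu]_x xi x <= r * - beta by rewrite ler_pM2l.
lra.
Qed.

(* Where [phi (Q t) <= 0] the next term is at most [expR (r * delta)], elsewhere
   it is at most the product; adding both bounds avoids indicator functions. *)
Lemma exp_drift_moment (P : probability T R) (nu : probability U R)
    (Q : nat -> T -> R) (X : nat -> T -> U) (phi : R -> R) (xi : U -> R)
    (r rho delta : R) :
  (forall t, measurable_fun setT (Q t)) ->
  (forall t, measurable_fun setT (X t)) ->
  (forall t A, measurable A -> P (X t @^-1` A) = nu A) ->
  (forall t (A : set R) B, measurable A -> measurable B ->
    P (Q t @^-1` A `&` X t @^-1` B) =
    (P (Q t @^-1` A) * P (X t @^-1` B))%E) ->
  measurable_fun setT phi -> measurable_fun setT xi ->
  (forall t, exists K, {ae P, forall z, phi (Q t z) <= K}) ->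
  {ae nu, forall x, xi x <= delta} ->
  (forall t, {ae P, forall z,
    (0 < phi (Q t z) -> phi (Q t.+1 z) <= phi (Q t z) + xi (X t z)) /\
    (phi (Q t z) <= 0 -> phi (Q t.+1 z) <= delta)}) ->
  0 <= r -> 0 <= rho < 1 -> \int[nu]_x expR (r * xi x) <= rho ->
  forall t, \int[P]_z expR (r * phi (Q t z)) <=
    rho ^+ t * \int[P]_z expR (r * phi (Q 0%N z)) +
    expR (r * delta) / (1 - rho).
Proof.
move=> mQ mX lawX indQX mphi mxi phiK xid drift r0 rho01 xirho.
have mphiQ t : measurable_fun setT (fun z => phi (Q t z)).
  exact: measurableT_comp.
have mxiX t : measurable_fun setT (fun z => xi (X t z)).
  exact: measurableT_comp.
have intQ t : P.-integrable setT (EFin \o (fun z => expR (r * phi (Q t z)))).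
  by have [K hK] := phiK t; exact: exp_integrable hK r0.
have xidX t : {ae P, forall z, xi (X t z) <= delta}.
  exact: (ae_law (mX t) (lawX t) xid).
have intX t : P.-integrable setT (EFin \o (fun z => expR (r * xi (X t z)))).
  exact: exp_integrable (xidX t) r0.
apply: geometric_recursion_le => // t.
have intQX : P.-integrable setT
    (EFin \o (fun z => expR (r * phi (Q t z)) * expR (r * xi (X t z)))).
  have [K hK] := phiK t.
  rewrite (_ : (fun z => _) =
      (fun z => expR (r * (phi (Q t z) + xi (X t z))))); last first.
    by apply/funext => z; rewrite mulrDr expRD.
  apply: (exp_integrable (K := K + delta)) => //.
    exact: measurable_funD.
  by apply: filterS2 hK (xidX t) => z; exact: lerD.
have intc : P.-integrable setT (EFin \o (fun=> expR (r * delta))).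
  by apply: (@ae_bounded_integrable _ _ _ _ _ `|expR (r * delta)|) => //;
    exact: nearW.
apply: (@le_trans _ _ (\int[P]_z
    (expR (r * phi (Q t z)) * expR (r * xi (X t z)) + expR (r * delta)))).
  apply: ae_le_Rintegral => //.
    exact: (@integrableD _ _ _ _ _ _ (EFin \o _) (EFin \o _)).
  apply: filterS (drift t) => z [dpos dneg].
  have [y0|y0] := ltP 0 (phi (Q t z)).
    rewrite -expRD -mulrDr ler_wpDr ?expR_ge0// ler_expR ler_wpM2l//.
    exact: dpos.
  rewrite ler_wpDl ?mulr_ge0 ?expR_ge0// ler_expR ler_wpM2l//.
  exact: dneg.
rewrite RintegralD// Rintegral_cst//= probability_setT mulr1 lerD2r.
have mf : measurable_fun setT (fun q => expR (r * phi q)).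
  by apply: measurableT_comp => //; exact: measurable_funM.
have mg : measurable_fun setT (fun x => expR (r * xi x)).
  by apply: measurableT_comp => //; exact: measurable_funM.
(* Independence of the queue and the current slot splits the moment; the slot factor is at most
   [rho]. *)
rewrite (Rintegral_indepM (mQ t) (mX t) mf mg _ _ (intQ t) (intX t))//;
  last exact: indQX.
rewrite mulrC (Rintegral_law (mX t) mg (lawX t) (intX t)) ler_wpM2r//.
by apply: Rintegral_ge0 => z _; exact: expR_ge0.
Qed.

(** Chernoff's bound: the indicator is pointwise at most [expR (r * (Y - y))]. The bound [K] serves
    integrability. *)
Lemma markov_exp (P : probability T R) (Y : T -> R) (r y K : R) :
  measurable_fun setT Y -> {ae P, forall z, Y z <= K} -> 0 <= r ->
  \int[P]_z (y <= Y z)%R%:R <= expR (- (r * y)) * \int[P]_z expR (r * Y z).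
Proof.
move=> mY YK r0; have intY := exp_integrable mY YK r0.
rewrite -RintegralZl//; apply: ae_le_Rintegral.
- apply: (@ae_bounded_integrable _ _ _ _ _ 1).
    by apply: measurable_natr_bool; exact: measurable_fun_ler.
  by apply: nearW => z; rewrite normr_nat; case: (y <= Y z); rewrite ?ler01.
- rewrite (_ : EFin \o _ =
      (fun z => (expR (- (r * y)))%:E * (expR (r * Y z))%:E)%E)//.
  exact: integrableZl.
- apply: nearW => z; rewrite -expRD.
  have [yY|_] := leP y (Y z); last by rewrite expR_ge0.
  rewrite (le_trans _ (expR_ge1Dx _))// lerDl.
  by rewrite addrC subr_ge0 ler_wpM2l.
Qed.

End exponential_moments.

(** * Time averages, finite sums and measurability of policies *)

Lemma time_avg_Rintegral d (T : measurableType d) (R : realType)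
    (P : probability T R) (f : nat -> T -> R) (t : nat) :
  (forall s, P.-integrable setT (EFin \o f s)) ->
  time_avg P f t = (t%:R^-1 * \sum_(0 <= s < t) \int[P]_z f s z)%:E.
Proof.
move=> intf; rewrite /time_avg EFinM -sumEFin; congr (_ * _)%E.
by apply: eq_bigr => s _; rewrite expectation_Rintegral.
Qed.

(** Every tail [B] meets a tail [A] on which [u] exceeds [l - e / k]; a single common index [n]
    forces the supremum of [v] over [B] above [c + k * l - e]. *)
Lemma limn_esup_affine_ge (R : realType) (u v : (\bar R)^nat) (c k l : R) :
  0 < k -> (forall n, (c%:E + k%:E * u n <= v n)%E) ->
  (l%:E <= limn_einf u)%E -> ((c + k * l)%:E <= limn_esup v)%E.
Proof.
move=> k0 uv lu; apply: le_ereal_inf_tmp => _ [B nB <-].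
apply/lee_addgt0Pr => e e0.
have [_ [A nA <-] Ae] : exists2 y, [set ereal_sup [set (- u x)%E | x in V] |
    V in \oo] y & (y < (- l + e / k)%:E)%E.
  apply: ereal_inf_lt; apply: (@le_lt_trans _ _ (- l%:E)%E).
    by rewrite leeNr.
  by rewrite -EFinN lte_fin ltrDl divr_gt0.
have [n [An Bn]] := filter_ex (filterI nA nB).
have un : ((l - e / k)%:E < u n)%E.
  rewrite -lteN2 -EFinN opprB addrC; apply: le_lt_trans Ae.
  by apply: ereal_sup_ubound; exists n.
have vn : ((c + k * l - e)%:E <= v n)%E.
  apply: le_trans (uv n).
  have -> : c + k * l - e = c + k * (l - e / k) by field; rewrite gt_eqF.
  by rewrite EFinD leeD2l// EFinM lee_wpmul2l ?lee_fin ?ltW.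
rewrite -leeBlDr// -EFinB (le_trans vn)//.
by apply: ereal_sup_ubound; exists n.
Qed.

(** The two conclusions are proved together: additivity at the head needs integrability of the
    remaining sum. *)
Lemma Rintegral_sum d (T : measurableType d) (R : realType)
    (mu : probability T R) (I : eqType) (s : seq I) (f : I -> T -> R) :
  (forall i, i \in s -> mu.-integrable setT (EFin \o f i)) ->
  \int[mu]_x (\sum_(i <- s) f i x) = \sum_(i <- s) \int[mu]_x f i x /\
  mu.-integrable setT (EFin \o (fun x => \sum_(i <- s) f i x)).
Proof.
elim: s => [|i s IH] intf.
  rewrite big_nil; under eq_Rintegral do rewrite big_nil.
  rewrite Rintegral_cst// mul0r; split => //.
  apply: (@ae_bounded_integrable _ _ _ _ _ 0).
    by under eq_fun do rewrite big_nil; exact: measurable_cst.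
  by apply: nearW => x; rewrite big_nil normr0.
have [|IH1 IH2] := IH; first by move=> j js; apply: intf; rewrite inE js orbT.
have inti : mu.-integrable setT (EFin \o f i) by apply: intf; exact: mem_head.
split.
  rewrite big_cons -IH1 -RintegralD//.
  by apply: eq_Rintegral => x _; rewrite big_cons.
rewrite (_ : EFin \o _ = (fun x => (f i x)%:E + (\sum_(j <- s) f j x)%:E)%E).
  exact: (@integrableD _ _ _ _ _ _ (EFin \o _) (EFin \o _)).
by apply/funext => x /=; rewrite big_cons.
Qed.

Section measurability.
Context (R : realType).

Context d (T : measurableType d) (P : probability T R)
  (a w : {RV P >-> R}^nat).

Lemma measurable_slot_pair t : measurable_fun setT (slot_pair a w t).
Proof.
apply: measurable_fun_pair.
- exact: (measurable_funP (a t)).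
- exact: (measurable_funP (w t)).
Qed.

(** The information of a slot is generated by preimages under measurable maps, so it is contained in
    the sigma-algebra of [T]. *)
Lemma control_algorithm_measurable (p : nat -> T -> bool) t :
  control_algorithm a w p -> measurable_fun setT (p t).
Proof.
move=> [d' [S [seed [_ /(_ t) info]]]]; apply: (measurable_fun_bool true).
rewrite setTI (_ : _ @^-1` _ = [set z | p t z]); last first.
  by apply/seteqP; split.
apply: smallest_sub info; first exact: sigma_algebra_measurable.
move=> A [[|]|].
- by move=> [B mB <-]; exact: (measurable_funP seed).
- by move=> [s _ [B mB <-]]; exact: (measurable_funP (a s)).
- by move=> [s _ [B mB <-]]; exact: (measurable_funP (w s)).
Qed.

End measurability.

(** * One slot of the algorithm *)

Section dpp_step.
Context (R : realType).
Implicit Types V q a w wb wmax : R.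

(** Service requires [q * w >= V >= wmax ^+ 2 >= w * w], hence [q >= w] when [w > 0]. *)
Lemma dpp_step_ge0 V q a w wmax : 0 <= q -> 0 <= a -> 0 <= w <= wmax ->
  wmax ^+ 2 <= V -> 0 <= q + a - (dpp_decision V q w)%:R * w.
Proof.
rewrite /dpp_decision => q0 a0 /andP[w0 wM] MV.
have [Vqw|_] := leP V (q * w); last by rewrite mul0r; lra.
have ww : w * w <= q * w.
  by apply: le_trans Vqw; apply: le_trans MV; rewrite expr2 ler_pM.
move: w0; rewrite le_eqVlt => /orP[/eqP <-|w0]; first by rewrite mulr0; lra.
by move: ww; rewrite ler_pM2r// mul1r; lra.
Qed.

(** Above [V / wb] every state from [wb] on is served; symmetrically, the next lemma uses that below
    [V / wb] no state up to [wb] is. *)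
Lemma dpp_service_ge V q w wb : 0 <= V -> 0 < wb -> 0 <= w -> V / wb < q ->
  (wb <= w)%R%:R * w <= (dpp_decision V q w)%:R * w.
Proof.
move=> V0 wb0 w0; rewrite ltr_pdivrMr// /dpp_decision => Vq.
have [wbw|_] := leP wb w; last by rewrite mul0r mulr_ge0.
by have -> : V <= q * w by nra.
Qed.

Lemma dpp_service_le V q w wb : 0 < wb -> 0 <= q -> 0 <= w -> q < V / wb ->
  (dpp_decision V q w)%:R * w <= (wb < w)%R%:R * w.
Proof.
move=> wb0 q0 w0; rewrite ltr_pdivlMr// /dpp_decision => Vq.
have [_|wwb] := ltP wb w; first by case: (V <= q * w); rewrite ?mul1r ?mul0r.
have -> : (V <= q * w) = false; last by rewrite !mul0r.
by apply/negbTE; rewrite -ltNge; nra.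
Qed.

(** With [wb = omega_b], [wb^-1] is the slope of [h] around [lambda], used as a Lagrange multiplier:
    the minimum is the least value of [p * (1 - w / wb)] over both decisions. *)
Lemma power_ge_affine (p : bool) w wb :
  Num.min 0 (1 - w / wb) + wb^-1 * (p%:R * w) <= p%:R.
Proof.
rewrite [wb^-1 * _]mulrC -mulrA; case: p; rewrite ?mul1r ?mul0r /=.
  have : Num.min 0 (1 - w / wb) <= 1 - w / wb by rewrite ge_min lexx orbT.
  by lra.
have : Num.min 0 (1 - w / wb) <= 0 by rewrite ge_min lexx.
by lra.
Qed.

End dpp_step.

Section states.
Context (R : realType) (M : nat) (st : nat -> R) (b : nat).
Context (hst0 : st 0%N = 0).
Context (hst : forall k, (k < M)%N -> st k < st k.+1).
Context (hb : (1 <= b <= M)%N).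

Lemma state_lt i j : (i < j)%N -> (j <= M)%N -> st i < st j.
Proof.
elim: j => // j IH; rewrite ltnS leq_eqVlt => /orP[/eqP->|ij] jM.
  exact: hst.
by apply: lt_trans (hst jM); apply: IH => //; exact: ltnW.
Qed.

Lemma state_leE i j : (i <= M)%N -> (j <= M)%N -> (st i <= st j) = (i <= j)%N.
Proof.
move=> iM jM; case: ltngtP => [ij|ji|->]; last by rewrite lexx.
- by rewrite ltW// state_lt.
- by rewrite leNgt state_lt.
Qed.

Lemma state_gt0 k : (0 < k)%N -> (k <= M)%N -> 0 < st k.
Proof. by rewrite -hst0; exact: state_lt. Qed.

Lemma state_ge0 k : (k <= M)%N -> 0 <= st k.
Proof. by move=> kM; rewrite -hst0 state_leE. Qed.

Lemma state_sum m k : (k <= M)%N ->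
  \sum_(m <= i < M.+1) st i * (st k == st i)%:R = (m <= k)%N%:R * st k.
Proof.
move=> kM; have stE i : (i < M.+1)%N -> (st k == st i) = (i == k).
  by move=> iM; rewrite eq_le !state_leE// -eqn_leq eq_sym.
transitivity (\sum_(m <= i < M.+1 | i == k) st i).
  rewrite [RHS]big_mkcond/=; apply: eq_big_nat => i /andP[_ iM].
  by rewrite stE//; case: eqP => _; rewrite ?mulr1 ?mulr0.
by rewrite big_nat1_eq ltnS kM andbT; case: leqP; rewrite ?mul1r ?mul0r.
Qed.

(* The two indicators are the events that the queue leaves the band where the
   states above [b] are served and those below [b] are not. When [b = 1] the
   second one is empty because [st 0 = 0]. *)
Lemma dpp_power_le V q k : 0 < V -> 0 <= q -> (k <= M)%N ->
  (dpp_decision V q (st k))%:R <=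
  Num.min 0 (1 - st k / st b) +
  (st b)^-1 * ((dpp_decision V q (st k))%:R * st k) +
  (1 + st M / st b) * ((q < V * inv_state M st b.+1)%R%:R +
                       (V <= q * st b.-1)%R%:R).
Proof.
move=> V0 q0 kM; have /andP[b1 bM] := hb.
have wb0 : 0 < st b by exact: state_gt0.
have wk0 : 0 <= st k by exact: state_ge0.
have kr : 0 <= st k / st b by rewrite divr_ge0// ltW.
have kMr : st k / st b <= st M / st b.
  by rewrite ler_pM2r ?invr_gt0// state_leE.
set i1 := (q < _)%R; set i2 := (V <= _)%R.
have i10 : 0 <= i1%:R :> R by [].
have i20 : 0 <= i2%:R :> R by [].
rewrite /dpp_decision [(st b)^-1 * _]mulrC -mulrA.
set u := st k / st b in kr kMr *; set K := st M / st b in kMr *.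
(* A wrong decision costs at most [u - 1] when a state above [b] is left idle and [1 - u] when one
   below [b] is served; [1 + K] covers both. *)
have [kb|kb] := leqP b k.
  have u1 : 1 <= u by rewrite /u ler_pdivlMr// mul1r state_leE.
  have -> : Num.min 0 (1 - u) = 1 - u by apply/min_idPr; lra.
  have [Vq|Vq] := leP V (q * st k).
    have : 0 <= (1 + K) * (i1%:R + i2%:R) by apply: mulr_ge0; lra.
    by rewrite /=; lra.
  (* In state [b] itself [u = 1], and idling costs as much as serving. *)
  have [bk|bk] := eqVneq b k.
    have -> : u = 1 by rewrite /u -bk mulfV// gt_eqF.
    have : 0 <= (1 + K) * (i1%:R + i2%:R) by apply: mulr_ge0; lra.
    by rewrite /=; lra.
  have bk' : (b < k)%N by rewrite ltn_neqAle bk.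
  have -> : i1.
    have bM' : (b.+1 <= M)%N by exact: leq_trans kM.
    have w1 : 0 < st b.+1 by exact: state_gt0.
    have : st b.+1 <= st k by rewrite state_leE.
    rewrite /i1 /inv_state bM' ltr_pdivlMr// => ?.
    by apply: le_lt_trans Vq; rewrite ler_wpM2l.
  have : (1 + K) * 1 <= (1 + K) * (1 + i2%:R) by apply: ler_wpM2l; lra.
  by rewrite /= mulr1 !mul0r; lra.
have u1 : u <= 1.
  by rewrite /u ler_pdivrMr// mul1r state_leE//; exact: ltnW.
have -> : Num.min 0 (1 - u) = 0 by apply/min_idPl; lra.
have [Vq|Vq] := leP V (q * st k); last first.
  have : 0 <= (1 + K) * (i1%:R + i2%:R) by apply: mulr_ge0; lra.
  by rewrite /=; lra.
have -> : i2.
  apply: le_trans Vq _; rewrite ler_wpM2l// state_leE//.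
    by rewrite -ltnS prednK.
  by rewrite (leq_trans (leq_pred _)).
have : (1 + K) * 1 <= (1 + K) * (i1%:R + 1) by apply: ler_wpM2l; lra.
by rewrite /= mulr1 mul1r; lra.
Qed.

End states.

(** * The stationary slot law *)

(* The slot space is abstract because inference of measurable and filter
   structures fails on the concrete product of two copies of the Borel line. *)
Section system.
Context (R : realType) d' (U : measurableType d') (nu : probability U R)
  (arr ch : U -> R) (M : nat) (st : nat -> R) (amax lambda : R) (b : nat).
Context (marr : measurable_fun setT arr) (mch : measurable_fun setT ch).
Context (hst0 : st 0%N = 0).
Context (hst : forall k, (k < M)%N -> st k < st k.+1).
Context (hnu : {ae nu, forall z, 0 <= arr z <= amax /\
                             exists2 k, (k <= M)%N & ch z = st k}).
Context (hlambda : (\int[nu]_z (arr z)%:E = lambda%:E)%E).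
Context (hb : (1 <= b <= M)%N).
(** This and the next definitions become those of the statement, by conversion, once [ch] is the
    second projection. *)
Let rate m := \sum_(m <= i < M.+1) st i * fine (nu [set z | ch z = st i]).
Context (hlb : rate b.+1 < lambda < rate b).
Let delta := delta_max M st amax.
Let betaR := rate b - lambda.
Let betaL := lambda - rate b.+1.
Let rR := betaR / (delta ^+ 2 + delta * betaR / 3).
Let rL := betaL / (delta ^+ 2 + delta * betaL / 3).
(** Per-slot contraction factors supplied by [bernstein_exp_moment]. *)
Let rhoR := 1 - rR * betaR / 2.
Let rhoL := 1 - rL * betaL / 2.

Lemma st_b_gt0 : 0 < st b.
Proof. by have /andP[] := hb; exact: state_gt0. Qed.

Lemma st_M_gt0 : 0 < st M.
Proof.
by have /andP[b0 bM] := hb; apply: (state_gt0 hst0 hst) => //;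
  exact: leq_trans bM.
Qed.

Lemma delta_max_gt0 : 0 < delta.
Proof. by rewrite /delta lt_max st_M_gt0. Qed.

Lemma state_le_delta k : (k <= M)%N -> st k <= delta.
Proof. by move=> kM; rewrite /delta le_max (state_leE hst)// kM. Qed.

Lemma amax_le_delta : amax <= delta.
Proof. by rewrite /delta le_max lexx orbT. Qed.

Lemma arrival_integrable : nu.-integrable setT (EFin \o (fun z => arr z)).
Proof.
apply: (ae_bounded_integrable (K := amax) marr).
by apply: (filterS _ hnu) => z [/andP[z0 za] _]; rewrite ger0_norm.
Qed.

Lemma arrival_mean : \int[nu]_z arr z = lambda.
Proof. by rewrite /Rintegral hlambda. Qed.

Lemma measurable_channel_eq k :
  measurable_fun setT (fun z : U =>
    (ch z == st k)%:R : R).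
Proof.
by apply/measurable_natr_bool/measurable_fun_eqr.
Qed.

Lemma measurable_channel_cut (c : R -> bool) :
  measurable_fun setT c ->
  measurable_fun setT (fun z : U =>
    (c (ch z))%:R * ch z : R).
Proof.
move=> mc; apply: measurable_funM; last exact: mch.
by apply: measurable_natr_bool; exact: measurableT_comp.
Qed.

Lemma channel_cut_norm (c : R -> bool) :
  {ae nu, forall z, 0 <= (c (ch z))%:R * ch z <= st M}.
Proof.
apply: (filterS _ hnu) => z [_ [k kM ->]].
have k0 := state_ge0 hst0 hst kM.
have kstM : st k <= st M by rewrite (state_leE hst).
have M0 := ltW st_M_gt0.
by case: (c _); rewrite ?mul1r ?mul0r ?lexx ?k0.
Qed.

Lemma channel_cut_integrable (c : R -> bool) :
  measurable_fun setT c ->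
  nu.-integrable setT (EFin \o (fun z => (c (ch z))%:R * ch z)).
Proof.
move=> mc; apply: (ae_bounded_integrable (K := st M)).
  exact: measurable_channel_cut.
by apply: (filterS _ (channel_cut_norm c)) => z /andP[z0 zM]; rewrite ger0_norm.
Qed.

(** Almost everywhere the cut channel is a finite combination of the indicators of [ch z = st k]
    with [m <= k], whose integrals are the state probabilities. *)
Lemma channel_cut_mean (c : R -> bool) (m : nat) :
  measurable_fun setT c ->
  (forall k, (k <= M)%N -> c (st k) = (m <= k)%N) ->
  \int[nu]_z ((c (ch z))%:R * ch z) = rate m.
Proof.
move=> mc cE.
have intk k : nu.-integrable setT (EFin \o (fun z => (ch z == st k)%:R : R)).
  apply: (ae_bounded_integrable (K := 1) (measurable_channel_eq k)).
  by apply: nearW => z; rewrite normr_nat; case: (ch z == st k); rewrite ?ler01.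
have intsk k : nu.-integrable setT
    (EFin \o (fun z => st k * (ch z == st k)%:R : R)).
  rewrite (_ : EFin \o _ = (fun z => (st k)%:E * ((ch z == st k)%:R)%:E)%E)//.
  exact: integrableZl (intk k).
have [sumE intsum] := @Rintegral_sum _ _ _ nu _ (index_iota m M.+1)
  (fun k z => st k * (ch z == st k)%:R) (fun k _ => intsk k).
transitivity (\int[nu]_z \sum_(m <= k < M.+1) st k * (ch z == st k)%:R).
  apply: ae_eq_Rintegral => //; first exact: channel_cut_integrable.
  apply: (filterS _ hnu) => z [_ [k kM ->]].
  by rewrite (state_sum hst)// cE.
rewrite sumE /rate; apply: eq_bigr => k _; rewrite RintegralZl//.
congr (_ * _); rewrite /Rintegral; congr fine.
have mk : measurable [set z | ch z = st k].
  rewrite (_ : [set z | _] = (fun z : U => ch z == st k) @^-1` [set true]).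
    rewrite -[X in measurable X]setTI.
    by apply: (measurable_fun_eqr mch (measurable_cst _) measurableT).
  by apply/seteqP; split => z /= /eqP.
transitivity (\int[nu]_z (\1_[set z | ch z = st k] z)%:E)%E.
  apply: eq_integral => z _; rewrite indicE.
  rewrite (_ : (z \in _) = (ch z == st k))//.
  by apply/idP/idP => [/set_mem/eqP//|/eqP zk]; exact: mem_set.
by rewrite integral_indic// setIT.
Qed.

(** Comparison increments: [xiR] bounds the increase of the queue above [V / omega_b], [xiL] its
    decrease below. Serving the states from [b] on, or only those above [b], gives them means
    [- betaR] and [- betaL]. *)
Let xiR (z : U) : R := arr z - (st b <= ch z)%R%:R * ch z.
Let xiL (z : U) : R := (st b < ch z)%R%:R * ch z - arr z.

Lemma measurable_ge_b : measurable_fun setT (fun x : R => st b <= x).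
Proof. exact: measurable_fun_ler. Qed.

Lemma measurable_gt_b : measurable_fun setT (fun x : R => st b < x).
Proof. exact: measurable_fun_ltr. Qed.

Lemma measurable_xiR : measurable_fun setT xiR.
Proof.
apply: measurable_funB; first exact: marr.
exact: (measurable_channel_cut measurable_ge_b).
Qed.

Lemma measurable_xiL : measurable_fun setT xiL.
Proof.
apply: measurable_funB; last exact: marr.
exact: (measurable_channel_cut measurable_gt_b).
Qed.

Lemma xiR_norm : {ae nu, forall z, `|xiR z| <= delta}.
Proof.
apply: filterS2 hnu (channel_cut_norm (fun x => st b <= x)).
move=> z [/andP[z0 za] _] /andP[c0 cM]; rewrite ler_norml /xiR.
have := amax_le_delta; have := state_le_delta (leqnn M).
by move=> ? ?; apply/andP; split; lra.
Qed.

Lemma xiL_norm : {ae nu, forall z, `|xiL z| <= delta}.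
Proof.
apply: filterS2 hnu (channel_cut_norm (fun x => st b < x)).
move=> z [/andP[z0 za] _] /andP[c0 cM]; rewrite ler_norml /xiL.
have := amax_le_delta; have := state_le_delta (leqnn M).
by move=> ? ?; apply/andP; split; lra.
Qed.

Lemma xiR_mean : \int[nu]_z xiR z = - betaR.
Proof.
have /andP[_ bM] := hb.
rewrite RintegralB//; last exact: (channel_cut_integrable measurable_ge_b).
  rewrite arrival_mean (channel_cut_mean (m := b) measurable_ge_b).
    by rewrite /betaR opprB.
  by move=> k kM; rewrite (state_leE hst).
exact: arrival_integrable.
Qed.

Lemma xiL_mean : \int[nu]_z xiL z = - betaL.
Proof.
have /andP[_ bM] := hb.
rewrite RintegralB//; first last.
- exact: arrival_integrable.
- exact: (channel_cut_integrable measurable_gt_b).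
rewrite arrival_mean (channel_cut_mean (m := b.+1) measurable_gt_b).
  by rewrite /betaL opprB.
by move=> k kM; rewrite ltNge (state_leE hst)// -ltnNge.
Qed.

Lemma beta_R_gt0 : 0 < betaR.
Proof. by rewrite /betaR subr_gt0; have /andP[] := hlb. Qed.

Lemma beta_L_gt0 : 0 < betaL.
Proof. by rewrite /betaL subr_gt0; have /andP[] := hlb. Qed.

Lemma r_R_gt0 : 0 < rR.
Proof. by have [] := exp_moment_rate delta_max_gt0 beta_R_gt0. Qed.

Lemma r_L_gt0 : 0 < rL.
Proof. by have [] := exp_moment_rate delta_max_gt0 beta_L_gt0. Qed.

Lemma xiR_exp_moment : \int[nu]_z expR (rR * xiR z) <= rhoR.
Proof.
apply: (bernstein_exp_moment delta_max_gt0 beta_R_gt0 erefl).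
- exact: measurable_xiR.
- exact: xiR_norm.
- by rewrite xiR_mean.
Qed.

Lemma xiL_exp_moment : \int[nu]_z expR (rL * xiL z) <= rhoL.
Proof.
apply: (bernstein_exp_moment delta_max_gt0 beta_L_gt0 erefl).
- exact: measurable_xiL.
- exact: xiL_norm.
- by rewrite xiL_mean.
Qed.

(** Nonnegativity holds because [rhoR] dominates an exponential moment. *)
Lemma rhoR_bounds : 0 <= rhoR < 1.
Proof.
apply/andP; split; last first.
  by have := mulr_gt0 r_R_gt0 beta_R_gt0; rewrite /rhoR; lra.
apply: le_trans xiR_exp_moment; apply: Rintegral_ge0 => z _; exact: expR_ge0.
Qed.

Lemma rhoL_bounds : 0 <= rhoL < 1.
Proof.
apply/andP; split; last first.
  by have := mulr_gt0 r_L_gt0 beta_L_gt0; rewrite /rhoL; lra.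
apply: le_trans xiL_exp_moment; apply: Rintegral_ge0 => z _; exact: expR_ge0.
Qed.

(** * Arbitrary policies *)

(** Value at rate 0 of the line of slope [1 / st b] through the vertices of [h] at [rate b.+1] and
    [rate b]; at [lambda] that line equals [h]. *)
Let c0 := \int[nu]_z Num.min 0 (1 - ch z / st b).

Lemma measurable_base_cost :
  measurable_fun setT (fun z => Num.min 0 (1 - ch z / st b)).
Proof.
apply: measurable_minr => //; apply: measurable_funB => //.
exact: measurable_funM.
Qed.

Lemma base_cost_norm :
  {ae nu, forall z, `|Num.min 0 (1 - ch z / st b)| <= st M / st b}.
Proof.
apply: filterS hnu => z [_ [k kM ->]].
have k0 := state_ge0 hst0 hst kM; have b0 := st_b_gt0.
have kMr : st k / st b <= st M / st b.
  by rewrite ler_pM2r ?invr_gt0// (state_leE hst).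
have k0r : 0 <= st k / st b by rewrite divr_ge0// ltW.
have [h|h] := leP 0 (1 - st k / st b); first by rewrite normr0; lra.
by rewrite ltr0_norm; lra.
Qed.

Lemma base_cost_le0 : c0 <= 0.
Proof.
have : 0 <= \int[nu]_z - Num.min 0 (1 - ch z / st b).
  by apply: Rintegral_ge0 => z _; rewrite oppr_ge0 ge_min lexx.
under eq_Rintegral do rewrite -mulN1r.
rewrite RintegralZl//; last first.
  exact: ae_bounded_integrable measurable_base_cost base_cost_norm.
by rewrite mulN1r oppr_ge0.
Qed.

Section process.
Context d (T : measurableType d) (P : probability T R) (X : nat -> T -> U).
Context (mX : forall t, measurable_fun setT (X t)).
Context (lawX : forall t A, measurable A -> P (X t @^-1` A) = nu A).

Lemma slot_ae t : {ae P, forall z, 0 <= arr (X t z) <= amax /\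
  exists2 k, (k <= M)%N & ch (X t z) = st k}.
Proof. exact: ae_law (mX t) (lawX t) hnu. Qed.

Lemma channel_bounds_ae t : {ae P, forall z, 0 <= ch (X t z) <= st M}.
Proof.
apply: filterS (slot_ae t) => z [_ [k kM ->]].
by rewrite (state_ge0 hst0 hst kM) (state_leE hst).
Qed.

Lemma slot_integrable (g : U -> R) (K : R) t : measurable_fun setT g ->
  {ae nu, forall x, `|g x| <= K} ->
  P.-integrable setT (EFin \o (g \o X t)).
Proof.
move=> mg gK; apply: (@ae_bounded_integrable _ _ _ _ _ K).
  exact: measurableT_comp.
exact: (ae_law (mX t) (lawX t) gK).
Qed.

Lemma arrival_integrable_slot t :
  P.-integrable setT (EFin \o (fun z => arr (X t z))).
Proof.
apply: (slot_integrable (K := amax) t marr).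
by apply: filterS hnu => z [/andP[z0 za] _]; rewrite ger0_norm.
Qed.

Lemma arrival_mean_slot t : \int[P]_z arr (X t z) = lambda.
Proof.
by rewrite (Rintegral_law (mX t) marr (lawX t) (arrival_integrable_slot t))
  arrival_mean.
Qed.

Lemma power_integrable (p : T -> bool) : measurable_fun setT p ->
  P.-integrable setT (EFin \o (fun z => (p z)%:R : R)).
Proof.
move=> mp; apply: (@ae_bounded_integrable _ _ _ _ _ 1).
  exact: measurable_natr_bool.
by apply: nearW => z; rewrite normr_nat; case: (p z); rewrite ?ler01.
Qed.

Lemma service_integrable (p : T -> bool) t : measurable_fun setT p ->
  P.-integrable setT (EFin \o (fun z => (p z)%:R * ch (X t z))).
Proof.
move=> mp; apply: (@ae_bounded_integrable _ _ _ _ _ (st M)).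
  apply: measurable_funM; first exact: measurable_natr_bool.
  exact: measurableT_comp.
apply: filterS (channel_bounds_ae t) => z /andP[w0 wM].
by case: (p z); rewrite ?mul1r ?mul0r ?normr0 ?ger0_norm// ltW// st_M_gt0.
Qed.

Lemma base_cost_integrable t : P.-integrable setT
  (EFin \o (fun z => Num.min 0 (1 - ch (X t z) / st b))).
Proof. exact: (slot_integrable t measurable_base_cost base_cost_norm). Qed.

Lemma base_cost_slot t :
  \int[P]_z Num.min 0 (1 - ch (X t z) / st b) = c0.
Proof.
exact: (Rintegral_law (mX t) measurable_base_cost (lawX t)
  (base_cost_integrable t)).
Qed.

Lemma integrable_scale (f : T -> R) (k : R) :
  P.-integrable setT (EFin \o f) ->
  P.-integrable setT (EFin \o (fun z => k * f z)).
Proof.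
move=> intf; rewrite (_ : EFin \o _ = (fun z => k%:E * (f z)%:E)%E)//.
exact: integrableZl intf.
Qed.

Lemma integrable_add (f g : T -> R) :
  P.-integrable setT (EFin \o f) -> P.-integrable setT (EFin \o g) ->
  P.-integrable setT (EFin \o (fun z => f z + g z)).
Proof.
move=> intf intg.
exact: (@integrableD _ _ _ _ _ _ (EFin \o _) (EFin \o _)).
Qed.

Lemma base_cost_service (p : T -> bool) t : measurable_fun setT p ->
  \int[P]_z (Num.min 0 (1 - ch (X t z) / st b) +
             (st b)^-1 * ((p z)%:R * ch (X t z))) =
  c0 + (st b)^-1 * \int[P]_z ((p z)%:R * ch (X t z)).
Proof.
move=> mp; have ints := service_integrable t mp.
rewrite RintegralD//; first by rewrite base_cost_slot RintegralZl.
- exact: base_cost_integrable.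
- exact: integrable_scale.
Qed.

Lemma policy_power_ge (p : T -> bool) t : measurable_fun setT p ->
  c0 + (st b)^-1 * \int[P]_z ((p z)%:R * ch (X t z)) <= \int[P]_z (p z)%:R.
Proof.
move=> mp; rewrite -base_cost_service//; apply: ae_le_Rintegral.
- apply: integrable_add; first exact: base_cost_integrable.
  exact/integrable_scale/service_integrable.
- exact: power_integrable.
- by apply: nearW => z; exact: power_ge_affine.
Qed.

(** * The queue process *)

Context (indX : mutually_independent P X).
Context (V q0 : R) (Q : nat -> T -> R).
Context (hV : st M ^+ 2 <= V) (hq0 : 0 <= q0 <= V / st b).
Context (Q0 : Q 0%N = cst q0).
Let serve t z : bool := dpp_decision V (Q t z) (ch (X t z)).
Context (QS : forall t z,
  Q t.+1 z = Num.max (Q t z + arr (X t z) - (serve t z)%:R * ch (X t z)) 0).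

Let step (x : R * U) : R :=
  Num.max (x.1 + arr x.2 - (dpp_decision V x.1 (ch x.2))%:R * ch x.2) 0.

Lemma V_gt0 : 0 < V.
Proof. by apply: lt_le_trans hV; rewrite exprn_gt0// st_M_gt0. Qed.

Lemma measurable_step : measurable_fun setT step.
Proof.
have m1 : measurable_fun setT (fun x : R * U => x.1) by exact: measurable_fst.
have ma : measurable_fun setT (fun x : R * U => arr x.2).
  exact: (measurableT_comp marr measurable_snd).
have mc : measurable_fun setT (fun x : R * U => ch x.2).
  exact: (measurableT_comp mch measurable_snd).
apply: measurable_maxr => //; apply: measurable_funB.
  exact: measurable_funD.
apply: measurable_funM => //; apply: measurable_natr_bool.
by apply: measurable_fun_ler => //; exact: measurable_funM.
Qed.

Lemma measurable_queue t : measurable_fun setT (Q t).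
Proof.
elim: t => [|t IH]; first by rewrite Q0; exact: measurable_cst.
rewrite (_ : Q t.+1 = step \o (fun z => (Q t z, X t z))).
  by apply: measurableT_comp;
    [exact: measurable_step|exact: measurable_fun_pair].
by apply/funext => z; rewrite QS.
Qed.

Lemma measurable_serve t : measurable_fun setT (serve t).
Proof.
apply: measurable_fun_ler => //; apply: measurable_funM.
  exact: measurable_queue.
exact: measurableT_comp.
Qed.

Lemma queue_slot_indep t (A : set R) B : measurable A -> measurable B ->
  P (Q t @^-1` A `&` X t @^-1` B) = (P (Q t @^-1` A) * P (X t @^-1` B))%E.
Proof.
exact: (recursion_indep_current measurable_step mX Q0 QS indX).
Qed.

Lemma queue_ge0 t z : 0 <= Q t z.
Proof.
case: t => [|t]; first by rewrite Q0; have /andP[] := hq0.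
by rewrite QS le_max lexx orbT.
Qed.

Lemma queue_step_ae t : {ae P, forall z,
  Q t.+1 z = Q t z + arr (X t z) - (serve t z)%:R * ch (X t z)}.
Proof.
apply: filterS2 (slot_ae t) (channel_bounds_ae t).
move=> z [/andP[a0 aM] _] w; rewrite QS; apply/max_idPl.
exact: (dpp_step_ge0 (queue_ge0 t z) a0 w hV).
Qed.

(** A crude bound growing with [t], which secures integrability; the uniform estimate comes from the
    exponential moments. *)
Lemma queue_le_ae t : {ae P, forall z, Q t z <= q0 + t%:R * amax}.
Proof.
elim: t => [|t IH].
  by apply: nearW => z; rewrite Q0 mul0r addr0.
apply: filterS3 IH (queue_step_ae t) (filterI (slot_ae t) (channel_bounds_ae
  t)).
move=> z Qz -> [[/andP[a0 aM] _] /andP[w0 wM]].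
have : 0 <= (serve t z)%:R * ch (X t z) by rewrite mulr_ge0.
rewrite -natr1 mulrDl mul1r; lra.
Qed.

Lemma queue_integrable t : P.-integrable setT (EFin \o Q t).
Proof.
apply: ae_bounded_integrable (measurable_queue t) _.
by apply: filterS (queue_le_ae t) => z; rewrite ger0_norm ?queue_ge0//; exact.
Qed.

(** Without truncation the queue recursion is an exact balance, so summing over slots telescopes. *)
Lemma service_mean t : \int[P]_z ((serve t z)%:R * ch (X t z)) =
  lambda + \int[P]_z Q t z - \int[P]_z Q t.+1 z.
Proof.
have ints := service_integrable t (measurable_serve t).
rewrite -(arrival_mean_slot t) -RintegralD//; last 2 first.
- exact: arrival_integrable_slot.
- exact: queue_integrable.
rewrite -RintegralB//; last 2 first.
- apply: integrable_add; first exact: arrival_integrable_slot.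
  exact: queue_integrable.
- exact: queue_integrable.
apply: ae_eq_Rintegral => //.
  apply: (@integrableB _ _ _ _ _ _ (EFin \o _) (EFin \o _)) => //.
    apply: integrable_add; first exact: arrival_integrable_slot.
    exact: queue_integrable.
  exact: queue_integrable.
by apply: filterS (queue_step_ae t) => z ->; lra.
Qed.

Lemma service_sum t :
  \sum_(0 <= s < t) \int[P]_z ((serve s z)%:R * ch (X s z)) =
  t%:R * lambda + q0 - \int[P]_z Q t z.
Proof.
elim: t => [|t IH].
  by rewrite big_geq// Q0 Rintegral_cst//= probability_setT mulr1; lra.
by rewrite big_nat_recr//= IH service_mean -natr1 mulrDl; lra.
Qed.

(** Additive constants of [exp_drift_moment]; they depend neither on [V] nor on time, which lets [C]
    be uniform in [eps]. *)
Let DR := expR (rR * delta) / (1 - rhoR).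
Let DL := expR (rL * delta) / (1 - rhoL).

Lemma DR_ge0 : 0 <= DR.
Proof.
have /andP[_ r1] := rhoR_bounds; rewrite /DR divr_ge0 ?expR_ge0//; lra.
Qed.

Lemma DL_ge0 : 0 <= DL.
Proof.
have /andP[_ r1] := rhoL_bounds; rewrite /DL divr_ge0 ?expR_ge0//; lra.
Qed.

Let phiR (q : R) := q - V / st b.
Let phiL (q : R) := V / st b - q.

Lemma measurable_phiR : measurable_fun setT phiR.
Proof. exact: measurable_funB. Qed.

Lemma measurable_phiL : measurable_fun setT phiL.
Proof. exact: measurable_funB. Qed.

Lemma phiR_le_ae t : {ae P, forall z,
  phiR (Q t z) <= q0 + t%:R * amax - V / st b}.
Proof. by apply: filterS (queue_le_ae t) => z; rewrite /phiR; lra. Qed.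

Lemma phiR_bounded t : exists K, {ae P, forall z, phiR (Q t z) <= K}.
Proof. by exists (q0 + t%:R * amax - V / st b); exact: phiR_le_ae. Qed.

Lemma phiL_le t z : phiL (Q t z) <= V / st b.
Proof. by have := queue_ge0 t z; rewrite /phiL; lra. Qed.

Lemma phiL_bounded t : exists K, {ae P, forall z, phiL (Q t z) <= K}.
Proof. by exists (V / st b); apply: nearW => z; exact: phiL_le. Qed.

(** As [q0 <= V / st b], the initial moment is at most 1 and there is no transient. *)
Lemma exp_moment_above t : \int[P]_z expR (rR * phiR (Q t z)) <= 1 + DR.
Proof.
have r0 := ltW r_R_gt0; have /andP[rho0 rho1] := rhoR_bounds.
have drift s : {ae P, forall z,
    (0 < phiR (Q s z) -> phiR (Q s.+1 z) <= phiR (Q s z) + xiR (X s z)) /\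
    (phiR (Q s z) <= 0 -> phiR (Q s.+1 z) <= delta)}.
  apply: filterS3 (queue_step_ae s) (slot_ae s) (channel_bounds_ae s).
  move=> z QSz [/andP[a0 aM] _] /andP[w0 wM]; rewrite /phiR QSz; split => h.
    have /(dpp_service_ge (ltW V_gt0) st_b_gt0 w0) : V / st b < Q s z by lra.
    by rewrite /xiR -/(serve s z); lra.
  have : 0 <= (serve s z)%:R * ch (X s z) by rewrite mulr_ge0.
  by have := amax_le_delta; lra.
have mom := exp_drift_moment measurable_queue mX lawX queue_slot_indep
  measurable_phiR measurable_xiR phiR_bounded _ drift
  r0 rhoR_bounds xiR_exp_moment t.
apply: le_trans (mom _) _.
  by apply: filterS xiR_norm => z; rewrite ler_norml => /andP[].
rewrite lerD2r Q0 /= Rintegral_cst//= probability_setT mulr1.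
rewrite mulr_ile1 ?expR_ge0 ?exprn_ge0 ?exprn_ile1 ?(ltW rho1)//.
rewrite -expR0 ler_expR mulr_ge0_le0//.
by have /andP[_] := hq0; rewrite /phiR; lra.
Qed.

(** The queue may start empty, so the initial moment can be exponential in [V]; its contribution
    decays geometrically. *)
Lemma exp_moment_below t : \int[P]_z expR (rL * phiL (Q t z)) <=
  rhoL ^+ t * expR (rL * (V / st b)) + DL.
Proof.
have r0 := ltW r_L_gt0; have /andP[rho0 rho1] := rhoL_bounds.
have drift s : {ae P, forall z,
    (0 < phiL (Q s z) -> phiL (Q s.+1 z) <= phiL (Q s z) + xiL (X s z)) /\
    (phiL (Q s z) <= 0 -> phiL (Q s.+1 z) <= delta)}.
  apply: filterS3 (queue_step_ae s) (slot_ae s) (channel_bounds_ae s).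
  move=> z QSz [/andP[a0 aM] _] /andP[w0 wM]; rewrite /phiL QSz; split => h.
    have /(dpp_service_le st_b_gt0 (queue_ge0 s z) w0) : Q s z < V / st b by
      lra.
    by rewrite /xiL -/(serve s z); lra.
  have : (serve s z)%:R * ch (X s z) <= ch (X s z).
    by case: (serve s z); rewrite ?mul1r ?mul0r.
  by have := state_le_delta (leqnn M); lra.
have mom := exp_drift_moment measurable_queue mX lawX queue_slot_indep
  measurable_phiL measurable_xiL phiL_bounded _ drift
  r0 rhoL_bounds xiL_exp_moment t.
apply: le_trans (mom _) _.
  by apply: filterS xiL_norm => z; rewrite ler_norml => /andP[].
rewrite lerD2r Q0 /= Rintegral_cst//= probability_setT mulr1.
rewrite ler_wpM2l ?exprn_ge0// ler_expR ler_wpM2l//.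
by have /andP[? _] := hq0; rewrite /phiL; lra.
Qed.

(** The excess [x] over [V / st b] satisfies [rR * x <= expR (rR * x)]. *)
Lemma queue_mean_le t : \int[P]_z Q t z <= V / st b + (1 + DR) / rR.
Proof.
have r0 := r_R_gt0.
have intE : P.-integrable setT (EFin \o (fun z => expR (rR * phiR (Q t z)))).
  apply: exp_integrable (phiR_le_ae t) (ltW r0).
  by apply: measurableT_comp (measurable_queue t); exact: measurable_phiR.
have intc : P.-integrable setT (EFin \o (fun=> V / st b)).
  by apply: (@ae_bounded_integrable _ _ _ _ _ `|V / st b|) => //; exact: nearW.
apply: (@le_trans _ _
    (\int[P]_z (V / st b + rR^-1 * expR (rR * phiR (Q t z))))).
  apply: ae_le_Rintegral; first exact: queue_integrable.
    exact/integrable_add/integrable_scale.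
  apply: nearW => z; rewrite -lerBlDl -/(phiR (Q t z)) ler_pdivlMl//.
  by apply: le_trans (expR_ge1Dx _); lra.
rewrite RintegralD//; last exact: integrable_scale.
rewrite Rintegral_cst//= probability_setT mulr1 lerD2l RintegralZl// mulrC.
by rewrite ler_pM2r ?invr_gt0// exp_moment_above.
Qed.

(** * Time outside the band *)

Lemma measurable_above t :
  measurable_fun setT (fun z => V <= Q t z * st b.-1).
Proof.
apply: measurable_fun_ler => //; apply: measurable_funM => //.
exact: measurable_queue.
Qed.

Lemma measurable_below t :
  measurable_fun setT (fun z => Q t z < V * inv_state M st b.+1).
Proof. by apply: measurable_fun_ltr => //; exact: measurable_queue. Qed.

Lemma above_prob_le (eps : R) t : 0 <= eps ->
  (b != 1%N -> expR (- (rR * (V / st b.-1 - V / st b))) <= eps) ->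
  \int[P]_z (V <= Q t z * st b.-1)%R%:R <= eps * (1 + DR).
Proof.
move=> eps0 tail; have DR0 := DR_ge0; have /andP[b1 bM] := hb.
have [b_eq1|b_neq1] := eqVneq b 1%N.
  (* For [b = 1] the event reads [V <= 0], since [st 0 = 0], and is empty. *)
  rewrite (_ : (fun z => _) = fun=> 0 : R); last first.
    by apply/funext => z; rewrite b_eq1 hst0 mulr0 leNgt V_gt0.
  by rewrite Rintegral_cst// mul0r mulr_ge0//; lra.
have b0 : (0 < b.-1)%N by rewrite -ltnS prednK// ltn_neqAle eq_sym b_neq1.
have stb0 : 0 < st b.-1.
  by apply: (state_gt0 hst0 hst) => //; exact: leq_trans (leq_pred _) bM.
apply: (@le_trans _ _
    (\int[P]_z (V / st b.-1 - V / st b <= phiR (Q t z))%R%:R)).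
  rewrite le_eqVlt; apply/orP; left; apply/eqP; apply: eq_Rintegral => z _.
  by rewrite /phiR lerD2r ler_pdivrMr.
apply: le_trans (markov_exp _ _ (phiR_le_ae t) (ltW r_R_gt0)) _.
  by apply: measurableT_comp (measurable_queue t); exact: measurable_phiR.
apply: ler_pM; rewrite ?expR_ge0 ?exp_moment_above ?tail//.
by apply: Rintegral_ge0 => z _; exact: expR_ge0.
Qed.

(** Markov gives [eps * (G + DL)] with [G] the transient. Bounding [eps * G] by [G] and cutting at 1
    keeps the sum over time linear in [V], although [G] starts exponentially large. *)
Lemma below_prob_le (eps : R) t : 0 <= eps <= 1 ->
  expR (- (rL * (V / st b - V * inv_state M st b.+1))) <= eps ->
  \int[P]_z (Q t z < V * inv_state M st b.+1)%R%:R <=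
  eps * DL + Num.min 1 (rhoL ^+ t * expR (rL * (V / st b))).
Proof.
move=> /andP[eps0 eps1] tail; have DL0 := DL_ge0.
have /andP[rho0 rho1] := rhoL_bounds.
set G := rhoL ^+ t * _; set A := \int[P]_z _.
have G0 : 0 <= G by rewrite mulr_ge0 ?exprn_ge0 ?expR_ge0.
have A1 : A <= 1.
  have -> : 1 = \int[P]_z (1 : R).
    by rewrite Rintegral_cst//= probability_setT mulr1.
  apply: ae_le_Rintegral; first exact/power_integrable/measurable_below.
    by apply: (@ae_bounded_integrable _ _ _ _ _ 1) => //;
      apply: nearW => z; rewrite normr1.
  by apply: nearW => z; case: (_ < _); rewrite ?ler01.
have AG : A <= eps * (G + DL).
  apply: (@le_trans _ _ (\int[P]_z
      (V / st b - V * inv_state M st b.+1 <= phiL (Q t z))%R%:R)).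
    apply: ae_le_Rintegral; first exact/power_integrable/measurable_below.
      apply: power_integrable; apply: measurable_fun_ler => //.
      by apply: measurableT_comp (measurable_queue t); exact: measurable_phiL.
    apply: nearW => z; rewrite /phiL lerD2l lerN2.
    by case: ltP => [/ltW ->|]//.
  apply: le_trans (markov_exp (K := V / st b) _ _ _ (ltW r_L_gt0)) _.
  - by apply: measurableT_comp (measurable_queue t); exact: measurable_phiL.
  - by apply: nearW => z; exact: phiL_le.
  - apply: ler_pM; rewrite ?expR_ge0 ?exp_moment_below//.
    by apply: Rintegral_ge0 => z _; exact: expR_ge0.
rewrite minEle; case: ifP => _.
  by apply: le_trans A1 _; rewrite lerDr mulr_ge0.
apply: le_trans AG _; rewrite mulrDr addrC lerD2l.
by rewrite -[leRHS]mul1r ler_wpM2r.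
Qed.

(** Sum [dpp_power_le] over the slots: the service term is known from [service_sum], and the two
    indicators are the probabilities just bounded. *)
Lemma power_sum_le (eps : R) t : 0 <= eps <= 1 ->
  (b != 1%N -> expR (- (rR * (V / st b.-1 - V / st b))) <= eps) ->
  expR (- (rL * (V / st b - V * inv_state M st b.+1))) <= eps ->
  \sum_(0 <= s < t) \int[P]_z (serve s z)%:R <=
  t%:R * (c0 + lambda / st b) + q0 / st b +
  (1 + st M / st b) * (t%:R * (eps * (1 + DR + DL)) +
                       2 * (1 + rL * (V / st b)) / (1 - rhoL)).
Proof.
move=> eps01 tailR tailL; have /andP[eps0 eps1] := eps01.
have b0 := st_b_gt0; have M0 := st_M_gt0.
have r0 := r_L_gt0; have /andP[rho0 rho1] := rhoL_bounds.
set K := 1 + st M / st b.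
have K0 : 0 <= K by rewrite addr_ge0// divr_ge0// ltW.
set G := expR (rL * (V / st b)).
have stepE s : \int[P]_z (serve s z)%:R <=
    c0 + (st b)^-1 * \int[P]_z ((serve s z)%:R * ch (X s z)) +
    K * (eps * (1 + DR + DL) + Num.min 1 (rhoL ^+ s * G)).
  have ms := measurable_serve s.
  have ib := power_integrable (measurable_below s).
  have ia := power_integrable (measurable_above s).
  apply: (@le_trans _ _ (\int[P]_z
    ((Num.min 0 (1 - ch (X s z) / st b) +
     (st b)^-1 * ((serve s z)%:R * ch (X s z))) +
     K * ((Q s z < V * inv_state M st b.+1)%R%:R +
          (V <= Q s z * st b.-1)%R%:R)))).
    apply: ae_le_Rintegral; first exact: power_integrable.
      apply: integrable_add.
        apply: integrable_add; first exact: base_cost_integrable.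
        exact/integrable_scale/service_integrable.
      exact/integrable_scale/integrable_add.
    apply: filterS (slot_ae s) => z [_ [k kM chk]].
    rewrite /serve chk.
    exact: (dpp_power_le hst0 hst hb V_gt0 (queue_ge0 s z) kM).
  rewrite RintegralD//; last 2 first.
  - apply: integrable_add; first exact: base_cost_integrable.
    exact/integrable_scale/service_integrable.
  - exact/integrable_scale/integrable_add.
  rewrite base_cost_service// lerD2l RintegralZl//; last exact: integrable_add.
  rewrite RintegralD// ler_wpM2l//.
  have := above_prob_le s eps0 tailR; have := below_prob_le s eps01 tailL.
  by rewrite -/G !mulrDr; lra.
apply: le_trans (ler_sum_nat (fun s _ => stepE s)) _.
rewrite big_split/= big_split/= -!mulr_sumr service_sum big_split/=.
rewrite !sumr_const_nat subn0 -[c0 *+ t]mulr_natl -[(eps * _) *+ t]mulr_natl.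
have Q0' : 0 <= \int[P]_z Q t z.
  by apply: Rintegral_ge0 => z _; exact: queue_ge0.
have geo : \sum_(0 <= s < t) Num.min 1 (rhoL ^+ s * G) <=
    2 * (1 + rL * (V / st b)) / (1 - rhoL).
  apply: le_trans (sum_min1_geometric_le _ rhoL_bounds (expR_ge0 _)) _.
  rewrite ler_pM2r ?invr_gt0 ?subr_gt0// ler_pM2l//.
  rewrite -[leRHS]expRK ler_ln ?posrE ?expR_gt0 ?addr_gt0 ?expR_gt0//.
  rewrite expRD -/G.
  (* As [G >= 1], [1 + G <= 2 * G <= expR 1 * G], so [ln (1 + G)] is at most
     [1 + rL * (V / st b)]. *)
  have e1 : 2 <= expR (1 : R) by apply: le_trans (expR_ge1Dx _); lra.
  have G1 : 1 <= G.
    rewrite -expR0 ler_expR mulr_ge0 ?(ltW r0)// divr_ge0 ?(ltW b0)//.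
    exact/ltW/V_gt0.
  have : 2 * G <= expR 1 * G by rewrite ler_wpM2r//; lra.
  by lra.
have KG := ler_wpM2l K0 geo.
have Qb : 0 <= (st b)^-1 * \int[P]_z Q t z.
  by rewrite mulr_ge0// invr_ge0 ltW.
by move: KG Qb; lra.
Qed.

End process.

(** [C] is chosen before the process, [eps] and [q0]. The bound [eps <= expR (-1)] gives [L >= 1],
    so constants are absorbed into multiples of [L]. *)
Lemma dpp_tradeoff (g : R) : 0 < g ->
  g <= rL * ((st b)^-1 - inv_state M st b.+1) ->
  (b != 1%N -> g <= rR * ((st b.-1)^-1 - (st b)^-1)) ->
  exists2 C : R, 0 < C &
  forall d (T : measurableType d) (P : probability T R) (X : nat -> T -> U),
  (forall t, measurable_fun setT (X t)) ->
  (forall t A, measurable A -> P (X t @^-1` A) = nu A) ->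
  mutually_independent P X ->
  forall eps : R, 0 < eps <= expR (-1) ->
  let L := ln eps^-1 in let V := Num.max (g^-1 * L) (st M ^+ 2) in
  forall q0 : R, 0 <= q0 <= V / st b ->
  forall Q : nat -> T -> R, Q 0%N = cst q0 ->
  let serve t z := dpp_decision V (Q t z) (ch (X t z)) in
  (forall t z,
    Q t.+1 z = Num.max (Q t z + arr (X t z) - (serve t z)%:R * ch (X t z)) 0) ->
  (forall t, \int[P]_z Q t z <= C * L) /\
  (forall t, L / eps < t%:R ->
    lambda - C * eps <=
      t%:R^-1 * \sum_(0 <= s < t) \int[P]_z ((serve s z)%:R * ch (X s z)) /\
    t%:R^-1 * \sum_(0 <= s < t) \int[P]_z (serve s z)%:R <=
      c0 + lambda / st b + C * eps).
Proof.
move=> g0 gL gR; have wb0 := st_b_gt0; have wM0 := st_M_gt0.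
have rR0 := r_R_gt0; have rL0 := r_L_gt0.
have /andP[_ rhoR1] := rhoR_bounds; have /andP[_ rhoL1] := rhoL_bounds.
pose DR := expR (rR * delta) / (1 - rhoR).
pose DL := expR (rL * delta) / (1 - rhoL).
have DR0 : 0 <= DR by rewrite divr_ge0 ?expR_ge0// subr_ge0 ltW.
have DL0 : 0 <= DL by rewrite divr_ge0 ?expR_ge0// subr_ge0 ltW.
(* Chosen so that [V / st b <= k * L]. Then [C1] bounds the mean queue over [L], [D2] the transient
   over [L], and [C2] collects the power error. *)
pose k := (g^-1 + st M ^+ 2) / st b.
have k0 : 0 <= k.
  by rewrite divr_ge0 ?addr_ge0 ?exprn_ge0 ?invr_ge0// ltW.
pose C1 := k + (1 + DR) / rR.
have C10 : 0 < C1 by rewrite ltr_wpDl// divr_gt0//; lra.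
pose K := 1 + st M / st b.
have K0 : 0 <= K by rewrite addr_ge0// divr_ge0// ltW.
pose D2 := 2 * (1 + rL * k) / (1 - rhoL).
have D20 : 0 <= D2.
  by rewrite divr_ge0 ?subr_ge0 ?(ltW rhoL1)// mulr_ge0// addr_ge0//
    mulr_ge0// ltW.
pose C2 := k / st b + K * (1 + DR + DL + D2).
have C20 : 0 <= C2.
  apply: addr_ge0; first exact: divr_ge0 k0 (ltW wb0).
  by apply: mulr_ge0 => //; lra.
exists (C1 + C2); first exact: ltr_wpDr.
move=> d T P X mX lawX indX eps /andP[eps0 eps1] L V q0 hq0 Q Q0 serve QS.
have L1 : 1 <= L.
  rewrite /L lnV ?posrE// lerNr -(expRK (-1)) ler_ln ?posrE ?expR_gt0//.
have epsE : expR (- L) = eps.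
  by rewrite /L lnV ?posrE// opprK lnK// posrE.
have epsle1 : eps <= 1.
  by apply: le_trans eps1 _; rewrite -[leRHS]expR0 ler_expR lerN10.
have hV : st M ^+ 2 <= V by rewrite le_max lexx orbT.
have gV : L <= g * V.
  by rewrite -ler_pdivrMl// le_max lexx.
have V0 : 0 <= V by apply: le_trans hV; rewrite exprn_ge0// ltW.
have Vk : V / st b <= k * L.
  rewrite /k mulrAC ler_pM2r ?invr_gt0// ge_max mulrDl; apply/andP; split.
    by rewrite lerDl mulr_ge0 ?exprn_ge0 ?(ltW wM0)//; lra.
  rewrite -[leLHS]mulr1 ler_wpDl ?mulr_ge0 ?invr_ge0 ?(ltW g0)//; first by lra.
  by rewrite ler_wpM2l// exprn_ge0// ltW.
(* The purpose of gamma: [r * (V * y) >= g * V >= L], and [expR (- L) = eps]. *)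
have tail r y : g <= r * y -> expR (- (r * (V * y))) <= eps.
  move=> gry; rewrite -[leRHS]epsE ler_expR lerN2 (le_trans gV)//.
  by rewrite mulrCA mulrC ler_wpM2l.
have tailL : expR (- (rL * (V / st b - V * inv_state M st b.+1))) <= eps.
  by rewrite -mulrBr; exact: tail.
have tailR : b != 1%N ->
    expR (- (rR * (V / st b.-1 - V / st b))) <= eps.
  by move=> b1; rewrite -mulrBr; apply/tail/gR.
have queue_le t : \int[P]_z Q t z <= C1 * L.
  apply: le_trans (queue_mean_le mX lawX indX hV hq0 Q0 QS t) _.
  rewrite [leRHS]mulrDl; apply: lerD => //; rewrite -[leLHS]mulr1.
  by apply: ler_wpM2l => //; apply: divr_ge0 (ltW rR0); rewrite addr_ge0.
have C2L : 0 <= C2 * L by rewrite mulr_ge0//; lra.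
split=> [t|t tL]; first by apply: le_trans (queue_le t) _;
  rewrite [leRHS]mulrDl lerDl.
have C2e : 0 <= C2 * eps by rewrite mulr_ge0// ltW.
have C1e : 0 <= C1 * eps by rewrite mulr_ge0// ltW.
have t0 : 0 < t%:R :> R.
  by apply: lt_trans tL; rewrite divr_gt0//; lra.
have Lt : L / t%:R <= eps.
  by rewrite ler_pdivrMr// mulrC -ler_pdivrMr// ltW.
have L0 : 0 <= L by lra.
(* Past [L / eps], any boundary term of order [L] is of order [eps] after averaging. *)
have scaled x : 0 <= x -> x * L / t%:R <= x * eps.
  by move=> x0; rewrite -mulrA ler_wpM2l.
have /andP[q00 q0V] := hq0.
split.
  rewrite (service_sum mX lawX hV hq0 Q0 QS).
  have -> : t%:R^-1 * (t%:R * lambda + q0 - \int[P]_z Q t z) =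
      lambda + q0 / t%:R - (\int[P]_z Q t z) / t%:R.
    by field; rewrite gt_eqF.
  have h1 : (\int[P]_z Q t z) / t%:R <= C1 * eps.
    by apply: le_trans (scaled _ (ltW C10)); rewrite ler_pM2r ?invr_gt0.
  have h2 : 0 <= q0 / t%:R by rewrite divr_ge0.
  by lra.
have eps01 : 0 <= eps <= 1 by rewrite ltW.
rewrite ler_pdivrMl//.
apply: le_trans (power_sum_le mX lawX indX hV hq0 Q0 QS t eps01 tailR tailL) _.
rewrite -/DR -/DL -/K -ler_pdivrMl//.
have -> : t%:R^-1 * (t%:R * (c0 + lambda / st b) + q0 / st b +
    K * (t%:R * (eps * (1 + DR + DL)) + 2 * (1 + rL * (V / st b)) / (1 -
      rhoL))) =
  c0 + lambda / st b + q0 / t%:R / st b +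
  K * (eps * (1 + DR + DL) + 2 * (1 + rL * (V / st b)) / (1 - rhoL) / t%:R).
  by field; rewrite !gt_eqF// subr_gt0.
have hq : q0 / t%:R / st b <= k / st b * eps.
  rewrite [leRHS]mulrAC ler_pM2r ?invr_gt0//.
  apply: le_trans (scaled _ k0); rewrite ler_pM2r ?invr_gt0//.
  exact: le_trans Vk.
have hD : 2 * (1 + rL * (V / st b)) / (1 - rhoL) / t%:R <= D2 * eps.
  apply: le_trans (scaled _ D20); rewrite ler_pM2r ?invr_gt0//.
  rewrite /D2 [leRHS]mulrAC ler_pM2r ?invr_gt0 ?subr_gt0//.
  have : rL * (V / st b) <= rL * (k * L) by rewrite ler_pM2l.
  by lra.
have := ler_wpM2l K0 hD; rewrite /C2; lra.
Qed.

End system.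

(** * The optimal power *)

(** Averaging [policy_power_ge] puts the power of any competitor above an increasing affine function
    of its service rate, so its rate constraint carries over to the upper limit of power. *)
Lemma pstar_ge (R : realType) (nu : slot_law R) (M : nat) (st : nat -> R)
    (amax lambda : R) (b : nat) :
  st 0%N = 0 -> (forall k, (k < M)%N -> st k < st k.+1) ->
  {ae nu, forall z, 0 <= z.1 <= amax /\ exists2 k, (k <= M)%N & z.2 = st k} ->
  (1 <= b <= M)%N ->
  ((\int[nu]_z Num.min 0 (1 - (z.2 : R) / st b) + lambda / st b)%:E <=
   pstar nu lambda)%E.
Proof.
move=> hst0 hst hnu hb; have wb0 := st_b_gt0 hst0 hst hb.
have mch : measurable_fun setT (fun z : measurableTypeR R * measurableTypeR R
  => z.2 : R).
  exact: measurable_snd.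
set c0 := \int[nu]_z _.
have c0_le0 : c0 <= 0 := base_cost_le0 mch hst0 hst hnu hb.
apply: le_ereal_inf_tmp => _ [d [T [P [a [w [p [[law indX] ctrl hserv ->]]]]]]].
have mX := measurable_slot_pair a w.
have mp t := control_algorithm_measurable t ctrl.
have ints s := service_integrable mch hst0 hst hnu hb mX law s (mp s).
rewrite [lambda / _]mulrC.
apply: (limn_esup_affine_ge _ _ hserv); first by rewrite invr_gt0.
move=> t; rewrite !time_avg_Rintegral//; last first.
  by move=> s; exact: power_integrable (mp s).
rewrite -EFinM -EFinD lee_fin.
(* At [t = 0] both averages are 0, and the claim reduces to [c0 <= 0]. *)
have [->|t0] := eqVneq t 0%N.
  by rewrite invr0 !mul0r mulr0 addr0.
have t1 : 0 < t%:R :> R by rewrite ltr0n lt0n.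
have sum_le : \sum_(0 <= s < t) (c0 + (st b)^-1 *
    \int[P]_z ((p s z)%:R * w s z)) <= \sum_(0 <= s < t) \int[P]_z (p s z)%:R.
  apply: ler_sum => s _.
  exact: (policy_power_ge mch hst0 hst hnu hb mX law s (mp s)).
rewrite big_split/= sumr_const_nat subn0 -mulr_sumr -mulr_natl in sum_le.
rewrite ler_pdivlMl//; apply: le_trans sum_le; rewrite le_eqVlt.
by apply/orP; left; apply/eqP; field; rewrite !gt_eqF.
Qed.

Theorem mainTheorem1 (R : realType) (M : nat) (st : nat -> R)
    (amax lambda : R) (nu : slot_law R) (b : nat)
    (hM : (1 <= M)%N)
    (hst0 : st 0%N = 0)
    (hst : forall k, (k < M)%N -> st k < st k.+1)
    (hnu : {ae nu, forall z, 0 <= z.1 <= amax /\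
                             exists2 k, (k <= M)%N & z.2 = st k})
    (hlambda : (\int[nu]_z (z.1)%:E = lambda%:E)%E)
    (hpi : forall k, (1 <= k <= M)%N -> 0 < state_prob nu st k)
    (hb : (1 <= b <= M)%N)
    (hlb : rate nu M st b.+1 < lambda < rate nu M st b) :
  exists C eps0 : R, [/\ 0 < C, 0 < eps0 < 1 &
    forall (d : measure_display) (T : measurableType d) (P : probability T R)
           (a w : {RV P >-> R}^nat),
      iid_slots nu a w ->
    forall eps : R, 0 < eps <= eps0 ->
    let V := V_param nu M st amax lambda b eps in
    forall q0 : R, 0 <= q0 <= V / st b ->
    let Q := dpp_queue V q0 a w in
    let p := dpp_power V q0 a w in
    (forall t : nat, (0 < t)%N ->
       (time_avg P Q t <= (C * ln (eps^-1))%:E)%E) /\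
    (forall t : nat, T_conv eps < t%:R ->
       ((lambda - C * eps)%:E <= time_avg P (service p w) t)%E /\
       (time_avg P (power R p) t <= pstar nu lambda + (C * eps)%:E)%E)].
Proof.
have /andP[b1 bM] := hb.
have wb0 := st_b_gt0 hst0 hst hb.
pose arr (z : measurableTypeR R * measurableTypeR R) : R := z.1.
pose ch (z : measurableTypeR R * measurableTypeR R) : R := z.2.
have marr : measurable_fun setT arr by exact: measurable_fst.
have mch : measurable_fun setT ch by exact: measurable_snd.
have rR0 : 0 < r_R nu M st amax lambda b.
  exact: (@r_R_gt0 _ _ _ nu ch _ _ amax lambda b hst0 hst hb hlb).
have rL0 : 0 < r_L nu M st amax lambda b.
  exact: (@r_L_gt0 _ _ _ nu ch _ _ amax lambda b hst0 hst hb hlb).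
have invb : inv_state M st b = (st b)^-1 by rewrite /inv_state bM.
have left0 : 0 < r_L nu M st amax lambda b *
    ((st b)^-1 - inv_state M st b.+1).
  rewrite mulr_gt0// subr_gt0 /inv_state; case: ifP => bM'.
    rewrite ltf_pV2 ?posrE//; first exact: hst.
    exact: (state_gt0 hst0 hst).
  by rewrite invr_gt0.
have right0 : b != 1%N -> 0 < r_R nu M st amax lambda b *
    ((st b.-1)^-1 - (st b)^-1).
  move=> bn1; have b0 : (0 < b.-1)%N by rewrite -ltnS prednK//
    ltn_neqAle eq_sym bn1.
  have bpM : (b.-1 < M)%N by rewrite prednK.
  have w0 : 0 < st b.-1 by apply: (state_gt0 hst0 hst) => //; exact: ltnW.
  rewrite mulr_gt0// subr_gt0 ltf_pV2 ?posrE//.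
  by have := hst _ bpM; rewrite prednK.
have bpM : (b.-1 <= M)%N by rewrite (leq_trans (leq_pred _)).
pose g := gamma nu M st amax lambda b.
have [g0 gL gR] : [/\ 0 < g,
    g <= r_L nu M st amax lambda b * ((st b)^-1 - inv_state M st b.+1) &
    b != 1%N ->
      g <= r_R nu M st amax lambda b * ((st b.-1)^-1 - (st b)^-1)].
  rewrite /g /gamma invb; have [_|bn1] := eqVneq b 1%N; first by split.
  have -> : inv_state M st b.-1 = (st b.-1)^-1 by rewrite /inv_state bpM.
  split.
  - by rewrite lt_min left0 right0.
  - by rewrite ge_min lexx orbT.
  - by rewrite ge_min lexx.
have [C C0 tradeoff] := dpp_tradeoff marr mch hst0 hst hnu hlambda hb hlb g0
  gL gR.
(* [eps0 = expR (-1)] is the threshold below which [ln (eps^-1) >= 1]. *)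
exists C, (expR (-1)); split=> //.
  by rewrite expR_gt0 -[ltRHS]expR0 ltr_expR ltrN10.
move=> d T P a w [law indX] eps heps V q0 hq0 Q p.
have mX := measurable_slot_pair a w.
have hV : st M ^+ 2 <= V by rewrite le_max lexx orbT.
have Q0 : Q 0%N = cst q0 by [].
have QS t z : Q t.+1 z = Num.max (Q t z + arr (slot_pair a w t z) -
    (dpp_decision V (Q t z) (ch (slot_pair a w t z)))%:R *
    ch (slot_pair a w t z)) 0 by [].
have [queue_le perf] := tradeoff d T P _ mX law indX eps heps q0 hq0 Q Q0 QS.
have mp s : measurable_fun setT (p s).
  exact: (measurable_serve marr mch mX Q0 QS s).
have intQ s := queue_integrable marr mch hst0 hst hnu mX law hV hq0 Q0 QS s.
have ints s := service_integrable mch hst0 hst hnu hb mX law s (mp s).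
have intp s := power_integrable P (mp s).
split=> [t t0|t tT].
  have t1 : 0 < t%:R :> R by rewrite ltr0n.
  rewrite time_avg_Rintegral// lee_fin ler_pdivrMl//.
  apply: le_trans (ler_sum_nat (fun s _ => queue_le s)) _.
  by rewrite sumr_const_nat subn0 -[leLHS]mulr_natl.
have [servT powT] := perf t tT.
rewrite !time_avg_Rintegral//; split; first by rewrite lee_fin.
(* The value of the line at [lambda] links the two bounds: the algorithm exceeds it by at most
   [C * eps], and [pstar] is not below it. *)
apply: (@le_trans _ _ (\int[nu]_z Num.min 0 (1 - ch z / st b) +
  lambda / st b + C * eps)%:E); first by rewrite lee_fin.
by rewrite EFinD leeD2r// (pstar_ge _ hst0 hst hnu hb).
Qed.
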